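(* Let $\mu \in \mathcal{P}(\mathbb{C}) \setminus \mathcal{P}_{\log_+}(\mathbb{C})$ and $\nu \in \mathcal{P}(\mathbb{C})$. Let $X_1, Y_1, X_2, Y_2, \ldots$ be a sequence of independent complex-valued random variables so that $X_j$ has distribution $\mu$ and $Y_j$ has distribution $\nu$ for each $j \geq 1$. For each $n \geq 1$, define \[ p_n(z) := \prod_{j=1}^n (z - X_j), \qquad q_n(z) := \prod_{j=1}^n (z - Y_j), \] let $\rho_n := \frac{1}{n} \sum_{j=1}^n \delta_{z_j^{(n)}}$ be the empirical measure constructed from the roots $z_1^{(n)}, \ldots, z_n^{(n)}$ (with multiplicity) of $p_n + q_n$, and let \[ S_n := \frac{1}{n} \left( \log M(p_n) - \log M(q_n) \right). \] Then: (1) If, with probability $1$, $\lim_{n\to\infty} S_n = +\infty$, then $\rho_n$ converges weakly almost surely to $\mu$ as $n \to \infty$. (2) If, with probability $1$, $\lim_{n\to\infty} S_n = -\infty$, then $\rho_n$ converges weakly almost surely to $\nu$ as $n \to \infty$. (3) If, with probability $1$, $\limsup_{n\to\infty} S_n = +\infty$ and $\liminf_{n\to\infty} S_n = -\infty$, then, with probability $1$, there is a subsequence along which $\rho_n$ converges weakly to $\mu$ and a separate subsequence along which $\rho_n$ converges weakly to $\nu$.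
   Context: $\mathcal{P}(\mathbb{C})$ is the set of (Borel) probability measures on $\mathbb{C}$. $\log_+ x = 0$ for $0 \le x \le 1$ and $\log_+ x = \log x$ for $x \ge 1$. $\mathcal{P}_{\log_+}(\mathbb{C})$ is the set of $\mu \in \mathcal{P}(\mathbb{C})$ with $\int_{\mathbb{C}} \log_+ |w| \, d\mu(w) < \infty$. The Mahler measure of a monic polynomial $f(z) = \prod_{j=1}^n (z - \alpha_j)$ is $M(f) := \prod_{j=1}^n \max\{|\alpha_j|, 1\}$. $\delta_z$ is the point mass at $z$. Deterministic probability measures $\rho_n$ converge weakly to $\rho$ if $\int \varphi \, d\rho_n \to \int \varphi \, d\rho$ for all continuous bounded $\varphi : \mathbb{C} \to \mathbb{C}$; random probability measures $\rho_n$ converge weakly almost surely to a deterministic $\rho$ if, for each continuous bounded $\varphi : \mathbb{C} \to \mathbb{C}$, this convergence holds almost surely. (It is known that exactly one of the three cases for $S_n$ always occurs.) *)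

(* Defs.v *)
From HB Require Import structures.
From mathcomp Require Import all_boot all_order all_algebra finmap.
From mathcomp Require Import all_classical all_reals all_analysis.
From mathcomp Require Import complex.

Set Implicit Arguments.
Unset Strict Implicit.
Unset Printing Implicit Defensive.

Import Order.TTheory GRing.Theory Num.Theory.
Import numFieldNormedType.Exports.

Local Open Scope classical_set_scope.
Local Open Scope ring_scope.

(* The alias R[i]^o is what carries the usual topology of the complex plane;
   [borelC R] is R[i] with the sigma-algebra generated by its open sets. *)
Definition borelC (R : realType) : Type := g_sigma_algebraType (@open R[i]^o).
HB.instance Definition _ (R : realType) := Measurable.copy (borelC R)
  (g_sigma_algebraType (@open R[i]^o)).

(* The norm of R[i] takes its values in R[i]; [normc] is R-valued. *)
Definition cabs (R : realType) (z : R[i]) : R := ComplexField.Normc.normc z.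

Definition log_plus (R : realType) (x : R) : R := if x <= 1 then 0 else ln x.

Definition P_log_plus (R : realType) : set (probability (borelC R) R) :=
  [set mu : probability (borelC R) R |
    (\int[mu]_w (log_plus (cabs (w : R[i])))%:E < +oo)%E].

(* Roots with multiplicity, in an arbitrary order; unspecified for p = 0. *)
Definition croots (R : realType) (p : {poly R[i]}) : seq R[i] :=
  sval (closed_field_poly_normal p).

Lemma crootsE (R : realType) (p : {poly R[i]}) :
  p = lead_coef p *: \prod_(z <- croots p) ('X - z%:P).
Proof. exact: svalP (closed_field_poly_normal p). Qed.

(* For monic p only: there is no leading coefficient factor. *)
Definition mahler (R : realType) (p : {poly R[i]}) : R :=
  \prod_(a <- croots p) Num.max (cabs a) 1.

(* For s = [::] this is the zero measure. *)
Definition empirical (R : realType) (s : seq R[i]) :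
    {measure set borelC R -> \bar R} :=
  mscale ((size s)%:R^-1)%:nng
    (msum (fun j => dirac (nth 0 s j : borelC R)) (size s)).

Definition cintegral (R : realType) (m : {measure set borelC R -> \bar R})
    (f : R[i] -> R[i]) : R[i] :=
  Complex (\int[m]_(w in setT) complex.Re (f w)) (\int[m]_(w in setT) complex.Im (f w)).

Definition test_function (R : realType) (phi : R[i]^o -> R[i]^o) : Prop :=
  continuous phi /\ bounded_fun phi.

Definition integral_cvg (R : realType)
    (rho : nat -> {measure set borelC R -> \bar R})
    (m : {measure set borelC R -> \bar R}) (phi : R[i]^o -> R[i]^o) : Prop :=
  (fun n => cintegral (rho n) phi : R[i]^o) @ \oo
    --> (cintegral m phi : R[i]^o).

Definition weak_cvg (R : realType)
    (rho : nat -> {measure set borelC R -> \bar R})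
    (m : {measure set borelC R -> \bar R}) : Prop :=
  forall phi, test_function phi -> integral_cvg rho m phi.

(* The exceptional null set may depend on the test function. *)
Definition weak_cvg_as (R : realType) (d : measure_display)
    (T : measurableType d) (P : probability T R)
    (rho : nat -> T -> {measure set borelC R -> \bar R})
    (m : {measure set borelC R -> \bar R}) : Prop :=
  forall phi, test_function phi ->
    {ae P, forall t, integral_cvg (rho ^~ t) m phi}.

Definition independent_RV (R : realType) (d d' : measure_display)
    (T : measurableType d) (T' : measurableType d') (P : probability T R)
    (I : choiceType) (Z : I -> {RV P >-> T'}) : Prop :=
  forall (J : {fset I}) (A : I -> set T'), (forall i, measurable (A i)) ->
    P (\bigcap_(i in [set` J]) (Z i @^-1` A i)) =
    (\prod_(i <- J) P (Z i @^-1` A i))%E.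

Definition has_law (R : realType) (d d' : measure_display)
    (T : measurableType d) (T' : measurableType d') (P : probability T R)
    (Z : {RV P >-> T'}) (m : probability T' R) : Prop :=
  forall A, measurable A -> distribution P Z A = m A.

Definition join_family (A : Type) (X Y : nat -> A) (i : nat + nat) : A :=
  match i with inl j => X j | inr j => Y j end.

Section RandomPolynomials.
Context (R : realType) (d : measure_display) (T : measurableType d).
Context (P : probability T R).

(* Random variables are indexed from 0: [X j] stands for X_(j+1). *)
Definition rpoly (X : nat -> {RV P >-> borelC R}) (n : nat) (t : T) :
    {poly R[i]} :=
  \prod_(j < n) ('X - (X j t : R[i])%:P).

Definition root_measure (X Y : nat -> {RV P >-> borelC R}) (n : nat) (t : T) :
    {measure set borelC R -> \bar R} :=
  empirical (croots (rpoly X n t + rpoly Y n t)).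

Definition mahler_diff (X Y : nat -> {RV P >-> borelC R}) (n : nat) (t : T) :
    R :=
  n%:R^-1 * (ln (mahler (rpoly X n t)) - ln (mahler (rpoly Y n t))).

End RandomPolynomials.

(* Main.v *)
Require Import Defs.
From HB Require Import structures.
From mathcomp Require Import all_boot all_order all_algebra finmap.
From mathcomp Require Import all_classical all_reals all_analysis.
From mathcomp Require Import measurable_realfun complex ring lra.

(** Fix one sample path, write p and q for the two polynomials of degree n with
    roots a_j and b_j, and M for the Mahler measure.

    On the disc |z| <= K the bound |q(z)| <= (1 + K)^n M(q) holds everywhere
    ([horner_upper]).  For p there is a converse bound |p(z)| >= k^n M(p), with
    k depending only on K and h, on at least one line in every vertical and in
    every horizontal strip of width h ([horner_lower]).  Indeed, on the line
    Re z = x the roots of p far from the disc contribute at least half of their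
    share of M(p), while the others contribute at least the product of the
    |x - Re a_j|; this is a monic real polynomial in x, and a monic polynomial
    of degree m reaches (h / 2e)^m on every interval of length h
    ([monic_large_value]).  Hence, as soon as S_n is large, |q| < |p| holds on
    the part inside a large disc of a grid of lines of small mesh.  No root of
    p + t q with 0 <= t <= 1 can lie there, and roots move continuously with t,
    so the sum over the roots of a function that is constant on the cells of
    the grid and vanishes far away is the same for p and for p + q
    ([root_sum_eq]).  Approximating a test function by such functions shows that
    the empirical measures of the roots of p and of p + q are close, up to the
    mass near infinity ([root_sum_close]).

    Chance enters only through the law of large numbers: along almost every
    path the empirical measures of X_1, ..., X_n are tight and converge weakly
    to mu, and likewise for the Y_j and nu.  This follows from the convergence
    of the frequencies of countably many square cells ([avg_cvg]), each of which
    is a strong law for pairwise independent events ([event_frequency_ae]).  As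
    the exceptional set does not depend on the test function, one may pass to
    subsequences that depend on the path.

    Case (2) is case (1) with p and q exchanged.  In case (3) one applies both
    along subsequences on which S_n tends to +oo through positive values and to
    -oo through negative values, which makes the two subsequences disjoint. *)

Set Implicit Arguments.
Unset Strict Implicit.
Unset Printing Implicit Defensive.

Import Order.TTheory GRing.Theory Num.Theory.
Import numFieldNormedType.Exports.
Local Open Scope classical_set_scope.
Local Open Scope ring_scope.

Local Notation Re := complex.Re.
Local Notation Im := complex.Im.

(** * Large values of monic polynomials on short intervals *)

Section FiniteDifferences.
Variable R : realType.
Implicit Types (f g : {poly R}) (c x : R).

Definition fdiff c f : {poly R} := (f \Po ('X + c%:P)) - f.

Lemma horner_fdiff c f x : (fdiff c f).[x] = f.[x + c] - f.[x].
Proof. by rewrite /fdiff hornerD hornerN horner_comp !hornerE. Qed.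

(** A forward difference lowers the degree by one, like a derivative, and acts in
    the same way on the leading coefficient.  Stating this through the
    coefficient of fixed index, and not through [lead_coef], covers the
    degenerate cases. *)
Lemma fdiff_lead c m f : (size f <= m.+2)%N ->
  (size (fdiff c f) <= m.+1)%N /\ (fdiff c f)`_m = m.+1%:R * c * f`_m.+1.
Proof.
have szXc : size ('X + c%:P : {poly R}) = 2 by rewrite size_XaddC.
have step g a : fdiff c (g * 'X + a%:P) =
    fdiff c g * 'X + c *: (g \Po ('X + c%:P)).
  rewrite /fdiff comp_polyD comp_polyM comp_polyX comp_polyC -mul_polyC.
  by set h := (_ \Po _); ring.
elim/poly_ind: f m => [|g a IH] m.
  by rewrite /fdiff comp_poly0 subrr size_poly0 !coef0 mulr0.
rewrite size_MXaddC; case: ifPn => [/andP[/eqP-> /eqP->] _|_ /=].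
  by rewrite mul0r add0r /fdiff comp_poly0 subrr size_poly0 !coef0 mulr0.
rewrite ltnS step !coefD !coefMX coefC addr0 coefZ /= => szg.
have sgc : (size (c *: (g \Po ('X + c%:P))) <= m.+1)%N.
  by rewrite (leq_trans (size_scale_leq _ _))// size_comp_poly2.
case: m szg sgc => [|m] szg sgc.
  have [k ->] : exists k, g = k%:P by eexists; exact: size1_polyC.
  rewrite /fdiff !comp_polyC subrr mul0r !add0r coefC eqxx mul1r; split=> //.
  exact: leq_trans (size_scale_leq _ _) (size_polyC_leq1 _).
have [sz co] := IH _ szg; split.
  rewrite (leq_trans (size_polyD _ _))// geq_max sgc andbT.
  by rewrite (leq_trans (size_polyMleq _ _))// size_polyX addn2.
rewrite /= co.
have -> : (g \Po ('X + c%:P))`_m.+1 = g`_m.+1.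
  have : (fdiff c g)`_m.+1 = 0 by rewrite nth_default.
  by rewrite /fdiff coefB => /eqP; rewrite subr_eq0 => /eqP.
by rewrite -[in RHS]natr1; ring.
Qed.

(** The [m]-th difference of [f] is the constant [m! c^m] times the leading
    coefficient, and each difference at most doubles the supremum over the nodes.
    Hence some node carries a large value. *)
Lemma fdiff_large_value c x m f : 0 <= c -> (size f <= m.+1)%N ->
  exists2 k : nat, (k <= m)%N &
    `|f`_m| * m`!%:R * (c / 2) ^+ m <= `|f.[x + k%:R * c]|.
Proof.
move=> c0; elim: m f => [|m IH] f sf.
  exists 0%N => //; have [k ->] : exists k, f = k%:P by eexists; exact: size1_polyC.
  by rewrite hornerC coefC eqxx fact0 !mulr1.
have [sz co] := fdiff_lead c sf.
have [k km] := IH _ sz; rewrite co horner_fdiff.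
set A := f.[x + k%:R * c].
have -> : x + k%:R * c + c = x + k.+1%:R * c by rewrite -natr1; ring.
set B := f.[_ + k.+1%:R * c]; rewrite !normrM normr_nat (ger0_norm c0) => le1.
set L := `|f`_m.+1| * _ * _.
have le2 : L *+ 2 <= `|B - A|.
  apply: le_trans le1; rewrite /L factS natrM exprS le_eqVlt; apply/orP; left.
  by apply/eqP; field.
have le3 : `|B - A| <= `|B| + `|A| by exact: ler_normB.
have [leA|ltA] := leP L `|A|; first by exists k => //; exact: leqW.
exists k.+1 => //; fold B; move: le2; rewrite mulr2n; lra.
Qed.

(** By induction, since (1 + 1/m)^m <= e. *)
Lemma fact_ge_expR m : (m%:R / expR 1) ^+ m <= m`!%:R :> R.
Proof.
elim: m => [|m IH]; first by rewrite expr0 fact0.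
have e0 := expR_gt0 (1 : R).
have [->|m0] := eqVneq m 0%N.
  rewrite expr1 factS fact0 muln1 ler_pdivrMr// mul1r.
  by have := expR_ge1Dx (1 : R); lra.
have m0' : 0 < m%:R :> R by rewrite ltr0n lt0n.
rewrite factS natrM exprS.
have -> : m.+1%:R / expR 1 * (m.+1%:R / expR 1) ^+ m =
  m.+1%:R * (((1 + m%:R^-1) ^+ m / expR 1) * (m%:R / expR 1) ^+ m) :> R.
  have -> : m.+1%:R / expR 1 = (1 + m%:R^-1) * (m%:R / expR 1) :> R.
    by rewrite -natr1; field; rewrite (gt_eqF e0) (gt_eqF m0').
  rewrite [X in _ * X]exprMn -natr1.
  by field; rewrite (gt_eqF e0) (gt_eqF m0').
rewrite ler_wpM2l// -[leRHS]mul1r; apply: ler_pM => //.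
rewrite ler_pdivrMr// mul1r -[1 in leRHS](@mulfV _ m%:R) ?gt_eqF//.
  rewrite mulrC expRM_natr lerXn2r// ?nnegrE ?addr_ge0 ?invr_ge0// ?expR_ge0//.
  exact: expR_ge1Dx.
Qed.

(** Finite differences with step [e / m], combined with m! >= (m / exp 1)^m, give a
    bound whose [m]-th root does not depend on [m]. *)
Lemma monic_large_value (s : seq R) (x0 e : R) : 0 <= e ->
  exists x, [/\ x0 <= x, x <= x0 + e &
    (e / (2 * expR 1)) ^+ size s <= \prod_(u <- s) `|x - u|].
Proof.
move=> e0; set m := size s.
pose f : {poly R} := \prod_(u <- s) ('X - u%:P).
have szf : size f = m.+1 by rewrite size_prod_XsubC.
have lf : f`_m = 1.
  by have /monicP := monic_prod_XsubC s xpredT id; rewrite lead_coefE szf.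
have [m0|m0] := eqVneq m 0%N.
  exists x0; split; rewrite ?lerDl//.
  by move: m0; rewrite /m => /size0nil ->; rewrite big_nil.
have m0' : 0 < m%:R :> R by rewrite ltr0n lt0n.
have c0 : 0 <= e / m%:R by rewrite divr_ge0.
have [k km] := fdiff_large_value x0 c0 (eq_leq szf).
rewrite lf normr1 mul1r => le1; exists (x0 + k%:R * (e / m%:R)); split.
- by rewrite lerDl mulr_ge0.
- by rewrite lerD2l mulrCA ler_piMr// ler_pdivrMr// mul1r ler_nat.
have -> : \prod_(u <- s) `|x0 + k%:R * (e / m%:R) - u| =
    `|f.[x0 + k%:R * (e / m%:R)]|.
  rewrite /f horner_prod normr_prod; apply: eq_bigr => u _.
  by rewrite !hornerE.
apply: le_trans le1.
have -> : (e / (2 * expR 1)) ^+ m = (m%:R / expR 1) ^+ m * (e / m%:R / 2) ^+ m.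
  by rewrite -exprMn; congr (_ ^+ _); field; rewrite (gt_eqF (expR_gt0 _)) (gt_eqF m0').
by rewrite ler_wpM2r ?fact_ge_expR// exprn_ge0// divr_ge0.
Qed.

End FiniteDifferences.

(** * The complex plane as a metric space *)

(** The ultrafilters of interest are pushed forward along the roots as functions of
    the homotopy parameter, which are not surjective. *)
Lemma ultra_fmap (S S' : Type) (f : S -> S') (F : set_system S) :
  UltraFilter F -> UltraFilter (f @ F).
Proof.
move=> FU; have FF : ProperFilter F by exact: ultra_proper.
split=> [|G GG FG]; first exact: fmap_proper_filter.
rewrite predeqE => A; split=> [GA|]; last exact: FG.
have [//|nA] := in_ultra_setVsetC (f @^-1` A) FU.
have /FG GnA : (f @ F) (~` A) by [].
by have [x []] := @filter_ex _ _ GG _ (filterI GA GnA).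
Qed.

Section ComplexPlane.
Variable R : realType.
Local Notation C := R[i].
Implicit Types (z w : C) (x y M : R).

Lemma cabs_ge0 z : 0 <= cabs z.
Proof. by case: z => a b; rewrite /cabs /= sqrtr_ge0. Qed.

Lemma cabs_normE z : `|z| = (cabs z)%:C%C.
Proof. by case: z => a b; rewrite normc_def. Qed.

Lemma cabsM z w : cabs (z * w) = cabs z * cabs w.
Proof. exact: ComplexField.Normc.normcM. Qed.

Lemma cabsD z w : cabs (z + w) <= cabs z + cabs w.
Proof. exact: le_normcD. Qed.

Lemma cabsN z : cabs (- z) = cabs z.
Proof. exact: normcN. Qed.

Lemma cabs0 : cabs (0 : C) = 0.
Proof. exact: ComplexField.Normc.normc0. Qed.

Lemma cabs1 : cabs (1 : C) = 1.
Proof. exact: ComplexField.Normc.normc1. Qed.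

Lemma cabsC z w : cabs (z - w) = cabs (w - z).
Proof. by rewrite -cabsN opprB. Qed.

Lemma cabs_real x : cabs x%:C%C = `|x|.
Proof. by rewrite /cabs /= expr0n addr0 sqrtr_sqr. Qed.

Lemma cabs_prod I (s : seq I) (F : I -> C) :
  cabs (\prod_(i <- s) F i) = \prod_(i <- s) cabs (F i).
Proof. exact: (big_morph _ cabsM cabs1). Qed.

Lemma cabs_ReIm z : [/\ `|Re z| <= cabs z, `|Im z| <= cabs z &
  cabs z <= `|Re z| + `|Im z|].
Proof.
case: z => a b; rewrite /cabs /=; split.
- by rewrite -sqrtr_sqr ler_wsqrtr// lerDl sqr_ge0.
- by rewrite -sqrtr_sqr ler_wsqrtr// lerDr sqr_ge0.
- rewrite -[leRHS]ger0_norm ?addr_ge0// -sqrtr_sqr ler_wsqrtr//.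
  rewrite sqrrD !real_normK ?num_real// lerD2r lerDl.
  by rewrite mulrn_wge0// mulr_ge0.
Qed.

Lemma ReB z w : Re (z - w) = Re z - Re w.
Proof. by case: z w => [? ?] [? ?]. Qed.

Lemma ImB z w : Im (z - w) = Im z - Im w.
Proof. by case: z w => [? ?] [? ?]. Qed.

(** Balls of [R[i]^o] have radii in [R[i]]; this reduces them to real radii. *)
Lemma nbhs_cabsP (z : C^o) (A : set C^o) :
  nbhs z A <-> exists2 d : R, 0 < d & forall w, cabs (w - z) < d -> A w.
Proof.
split=> [/nbhs_ballP[[d d'] /=]|[d d0 dA]].
  rewrite ltcE /= => /andP[/eqP-> d0 dA]; exists d => // w wz.
  by apply: dA; rewrite /ball /= cabs_normE ltcR cabsC.
apply/nbhs_ballP; exists d%:C%C => /=; first by rewrite ltcR.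
move=> w; rewrite /ball /= cabs_normE ltcR cabsC; exact: dA.
Qed.

Definition square M : set C^o := [set z | `|Re z| <= M /\ `|Im z| <= M].

(** An ultrafilter on the square converges as soon as its two coordinates do. *)
Lemma compact_square M : compact (square M).
Proof.
rewrite compact_ultra => F UF FM.
have FF : ProperFilter F by exact: ultra_proper.
have lim1 (f : C -> R) : (forall z, square M z -> `|f z| <= M) ->
    exists2 a, `|a| <= M & f @ F --> a.
  move=> fM; have := @segment_compact R (- M) M; rewrite compact_ultra.
  move=> /(_ (f @ F) (ultra_fmap f UF))[].
    have sub : square M `<=` f @^-1` `[- M, M].
    by move=> z /fM; rewrite ler_norml /= in_itv.
  exact: filterS sub FM.
  by move=> a [/= aM fa]; exists a => //; rewrite ler_norml; move: aM; rewrite in_itv.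
have [|a aM fa] := lim1 (@Re R); first by move=> z [].
have [|b bM fb] := lim1 (@Im R); first by move=> z [].
exists (a +i* b)%C; split => // A /nbhs_cabsP[d d0 dA].
have d20 : 0 < d / 2 by rewrite divr_gt0.
have /cvgrPdist_lt /(_ _ d20) Fa := fa.
have /cvgrPdist_lt /(_ _ d20) Fb := fb.
apply: filterS2 Fa Fb => z za zb; apply: dA.
have [_ _ /le_lt_trans->//] := cabs_ReIm (z - (a +i* b)%C).
rewrite ReB ImB /= (distrC (Re z)) (distrC (Im z)).
by rewrite [ltRHS](splitr d) ltrD.
Qed.

(** Real radii are easier to combine than those of the topology of [R[i]^o]. *)
Definition cont_at (f : C -> R) z :=
  forall e, 0 < e -> exists2 d, 0 < d & forall w, cabs (w - z) < d -> `|f w - f z| < e.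

(** Only one of the two points has to lie in the compact set, because a covering
    argument controls a whole neighbourhood of it. *)
Lemma cont_uniform (f : C -> R) M e : (forall z, cont_at f z) -> 0 < e ->
  exists2 d, 0 < d &
    forall z w, cabs z <= M -> cabs (w - z) < d -> `|f w - f z| < e.
Proof.
move=> fc e0; have := @compact_square M.
rewrite compact_near_coveringP => /(_ R 0^'+
  (fun d z => forall w, cabs (w - z) < d -> `|f w - f z| < e)).
case=> [z zM|d /= d0 H].
  have [d d0 dH] := fc z _ (divr_gt0 e0 (ltr0n _ 2)).
  have d20 : 0 < d / 2 by rewrite divr_gt0.
  exists ([set w | cabs (w - z) < d / 2], [set t | t < d / 2]) => /=.
    split; last exact: nbhs_right_lt.
    by apply/nbhs_cabsP; exists (d / 2).
  move=> [y t] /= [yz td] w wy.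
  have -> : f w - f y = (f w - f z) - (f y - f z) by ring.
  rewrite (le_lt_trans (ler_normB _ _))// [ltRHS]splitr ltrD// dH//.
    have -> : w - z = (w - y) + (y - z) by ring.
    rewrite (le_lt_trans (cabsD _ _))// [ltRHS]splitr ltrD//.
    exact: lt_trans td.
  by rewrite (lt_le_trans yz)// ler_pdivrMr// ler_peMr// ?ler1n// ltW.
have d20 : 0 < d / 2 by rewrite divr_gt0.
exists (d / 2) => // z w zM; apply: H => //.
- by rewrite /= sub0r normrN gtr0_norm// ltr_pdivrMr// ltr_pMr// ltr1n.
- by have [rz iz _] := cabs_ReIm z; split; [exact: le_trans zM|exact: le_trans zM].
Qed.

End ComplexPlane.

(** * Roots of a linear homotopy between polynomials *)

Lemma poly_eq_values (F : numFieldType) (p q : {poly F}) :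
  (forall x, p.[x] = q.[x]) -> p = q.
Proof.
move=> pq; apply/eqP; rewrite -subr_eq0; apply/negPn/negP => d0.
pose s : seq F := [seq i%:R | i <- iota 0 (size (p - q))].
suff : (size s < size (p - q)%R)%N by rewrite size_map size_iota ltnn.
apply: max_poly_roots => //.
- by apply/allP => x _; rewrite /root !hornerE pq subrr.
- by rewrite map_inj_uniq ?iota_uniq// => i j /eqP; rewrite eqr_nat => /eqP.
Qed.

Lemma big_mkseq (V : Type) (idx : V) (op : V -> V -> V) (I : Type) (g : nat -> I)
    n (F : I -> V) :
  \big[op/idx]_(x <- mkseq g n) F x = \big[op/idx]_(i < n) F (g i).
Proof.
by rewrite big_map -[X in iota 0 X]subn0 -/(index_iota 0 n) big_mkord.
Qed.

Section RootHomotopy.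
Variable R : realType.
Local Notation C := R[i].
Implicit Types (z w : C) (p q : {poly C}).

Lemma size_croots p : p != 0 -> size (croots p) = (size p).-1.
Proof.
move=> p0; rewrite {2}(crootsE p) size_scale ?lead_coef_eq0//.
by rewrite size_prod_XsubC.
Qed.

Lemma root_croots p z : z \in croots p -> p.[z] = 0.
Proof.
rewrite -root_prod_XsubC => /rootP pz0.
by rewrite (crootsE p) hornerZ pz0 mulr0.
Qed.

Section Limits.
Context (S : Type) (U : set_system S) (UF : ProperFilter U).
Implicit Types (g h : S -> C) (u v : C).

(** Convergence for the topology carried by [R[i]^o], of functions whose sums and
    products are taken in [R[i]]. *)
Definition cvgC g u : Prop := (g : S -> C^o) @ U --> (u : C^o).

Lemma cvgC_cst u : cvgC (fun=> u) u.
Proof. exact: cvg_cst. Qed.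

Lemma cvgC_add g h u v : cvgC g u -> cvgC h v -> cvgC (fun t => g t + h t) (u + v).
Proof. exact: (@cvgD _ C^o). Qed.

Lemma cvgC_opp g u : cvgC g u -> cvgC (fun t => - g t) (- u).
Proof. exact: (@cvgN _ C^o). Qed.

Lemma cvgC_mul g h u v : cvgC g u -> cvgC h v -> cvgC (fun t => g t * h t) (u * v).
Proof. exact: (@cvgM C). Qed.

Lemma cvgC_prod n (g : nat -> S -> C) (u : nat -> C) :
  (forall i, (i < n)%N -> cvgC (g i) (u i)) ->
  cvgC (fun t => \prod_(i < n) g i t) (\prod_(i < n) u i).
Proof.
elim: n => [|n IH] gu.
  by under eq_fun do rewrite big_ord0; rewrite big_ord0; exact: cvgC_cst.
under eq_fun do rewrite big_ord_recr; rewrite big_ord_recr /=.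
by apply: cvgC_mul; [apply: IH => i /ltnW; exact: gu | exact: gu].
Qed.

Lemma cvgC_unique g u v : cvgC g u -> cvgC g v -> u = v.
Proof. exact: (@cvg_unique C^o). Qed.

End Limits.

(** Clamping extends the homotopy to all real parameters, so that a locally constant
    function of the parameter is constant because its derivative vanishes on the
    whole line. *)
Definition unitclamp (t : R) : R := Num.max 0 (Num.min t 1).

Lemma unitclamp_ge0 t : 0 <= unitclamp t.
Proof. by rewrite le_max lexx. Qed.

Lemma unitclamp_le1 t : unitclamp t <= 1.
Proof. by rewrite ge_max ler01 ge_min lexx orbT. Qed.

Lemma unitclamp_continuous : continuous unitclamp.
Proof.
move=> t; apply: (@continuous_max _ _ (cst 0 : R -> R^o) (fun s => Num.min s 1)).
  exact: cvg_cst.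
by apply: (@continuous_min _ _ (id : R -> R^o) (cst 1)); [exact: cvg_id | exact: cvg_cst].
Qed.

Definition homotopy p q (t : R) : {poly C} := p + (unitclamp t)%:C%C *: q.

Section Homotopy.
Variables (a b : seq C) (n : nat).
Hypotheses (sa : size a = n) (sb : size b = n).
Let p := \prod_(z <- a) ('X - z%:P).
Let q := \prod_(z <- b) ('X - z%:P).
Let f := homotopy p q.
Let lead t : C := 1 + (unitclamp t)%:C%C.

Let lead_neq0 t : lead t != 0.
Proof.
by rewrite gt_eqF// (@lt_le_trans _ _ 1)// lerDl lecR unitclamp_ge0.
Qed.

Let szp : size p = n.+1. Proof. by rewrite size_prod_XsubC sa. Qed.
Let szq : size q = n.+1. Proof. by rewrite size_prod_XsubC sb. Qed.

Let coefn t : (f t)`_n = lead t.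
Proof.
rewrite /f /homotopy coefD coefZ.
have /monicP := monic_prod_XsubC a xpredT id; rewrite lead_coefE -/p szp => ->.
have /monicP := monic_prod_XsubC b xpredT id; rewrite lead_coefE -/q szq => ->.
by rewrite mulr1.
Qed.

Lemma size_homotopy t : size (f t) = n.+1.
Proof.
apply/eqP; rewrite eqn_leq; apply/andP; split.
  rewrite (leq_trans (size_polyD _ _))// geq_max szp leqnn/=.
  by rewrite (leq_trans (size_scale_leq _ _))// szq.
by rewrite ltnNge; apply/negP => /leq_sizeP/(_ _ (leqnn _))/eqP; rewrite coefn (negbTE (lead_neq0 t)).
Qed.

Lemma size_homotopy_roots t : size (croots (f t)) = n.
Proof.
by rewrite size_croots ?size_homotopy// -size_poly_eq0 size_homotopy.
Qed.

Lemma homotopyE t : f t = lead t *: \prod_(z <- croots (f t)) ('X - z%:P).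
Proof. by rewrite {1}(crootsE (f t)) lead_coefE size_homotopy coefn. Qed.

Lemma homotopy_root_le t z : z \in croots (f t) -> cabs p.[z] <= cabs q.[z].
Proof.
move=> /root_croots/eqP; rewrite hornerD hornerZ addr_eq0 => /eqP->.
rewrite cabsN cabsM cabs_real ger0_norm ?unitclamp_ge0//.
by rewrite ler_piMl ?cabs_ge0 ?unitclamp_le1.
Qed.

(** The leading coefficient [1 + t] is at least 1 and the others are bounded
    uniformly in [t], so Cauchy's bound on the roots is uniform. *)
Lemma homotopy_roots_bounded :
  exists M, forall t z, z \in croots (f t) -> square M z.
Proof.
pose A := \sum_(i < n) (cabs p`_i + cabs q`_i).
(* The summand 1 covers the unit disc, where comparing powers of [z] fails. *)
exists (1 + A) => t z zt.
have A0 : 0 <= A by rewrite sumr_ge0// => i _; rewrite addr_ge0 ?cabs_ge0.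
suff zA : cabs z <= 1 + A.
  by have [rz iz _] := cabs_ReIm z; split; exact: le_trans zA.
have [z1|z1] := leP (cabs z) 1; first by rewrite (le_trans z1)// lerDl.
have zn1 k : 1 <= cabs z ^+ k by rewrite exprn_ege1// ltW.
case: (posnP n) => [n0|n0].
  by have := size_homotopy_roots t; rewrite n0 => /size0nil e; rewrite e in zt.
have := root_croots zt; rewrite (horner_coef_wide z (eq_leq (size_homotopy t))).
rewrite big_ord_recr /= coefn addrC => /eqP; rewrite addr_eq0 => /eqP E.
have cabsX k : cabs (z ^+ k) = cabs z ^+ k.
  by elim: k => [|k IH]; rewrite ?expr0 ?cabs1// !exprS cabsM IH.
have le1 : cabs z ^+ n <= cabs (lead t * z ^+ n).
  rewrite cabsM cabsX ler_peMl ?exprn_ge0 ?cabs_ge0//.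
  have -> : lead t = (1 + unitclamp t)%:C%C by rewrite /lead rmorphD.
  by rewrite cabs_real ger0_norm ?addr_ge0 ?unitclamp_ge0// lerDl unitclamp_ge0.
have le2 : cabs (lead t * z ^+ n) <= A * cabs z ^+ n.-1.
  rewrite E cabsN mulr_suml.
  apply: (@le_trans _ _ (\sum_(i < n) cabs ((f t)`_i * z ^+ i))).
    elim/big_ind2 : _ => [|x1 x2 y1 y2 h1 h2|//]; first by rewrite cabs0.
    by rewrite (le_trans (cabsD _ _))// lerD.
  apply: ler_sum => i _; rewrite cabsM cabsX ler_pM ?cabs_ge0 ?exprn_ge0 ?cabs_ge0//.
    rewrite coefD coefZ (le_trans (cabsD _ _))// lerD2l cabsM cabs_real.
    by rewrite ger0_norm ?unitclamp_ge0// ler_piMl ?cabs_ge0 ?unitclamp_le1.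
  by apply: ler_weXn2l; [exact: ltW | rewrite -ltnS prednK].
have := le_trans le1 le2; rewrite -{1}(prednK n0) exprS ler_pM2r.
  by move=> zA; rewrite (le_trans zA)// lerDr.
by rewrite (lt_le_trans ltr01).
Qed.

Definition locally_const (psi : C -> R) z :=
  exists2 d, 0 < d & forall w, cabs (w - z) < d -> psi w = psi z.

Variable psi : C -> R.
Hypothesis psiP : forall z, cabs p.[z] <= cabs q.[z] -> locally_const psi z.
Let F t : R := \sum_(z <- croots (f t)) psi z.

(** Continuity of roots, without ordering them continuously: along an ultrafilter
    converging to [t0] each bounded root function has a limit, and since
    evaluation passes to the limit these limits are the roots of [f t0].  Near
    each of them [psi] is constant. *)
Lemma root_sum_locally_const t0 : \forall t \near t0, F t = F t0.
Proof.
(* If the claim failed, some ultrafilter would converge to [t0] outside [A]. *)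
apply: contrapT => nA; pose A := [set t | F t = F t0].
have G0F : ProperFilter (within (~` A) (nbhs t0)).
  apply: Build_ProperFilter => G0; apply: nA.
  have sub : [set t | (~` A) t -> set0 t] `<=` A.
    by move=> t nt; apply: contrapT => /nt.
  exact: (@filterS _ (nbhs t0) _ _ _ sub G0).
have [U [UU G0U]] := ultraFilterLemma G0F.
have UF : ProperFilter U by exact: ultra_proper.
have UnA : U (~` A) by apply: G0U; exact: withinT.
have Ut0 : U --> t0.
  move=> B Bt0; apply: G0U.
  have sub : B `<=` [set t | (~` A) t -> B t] by move=> t Bt _.
  exact: (@filterS _ (nbhs t0) _ _ _ sub Bt0).
have [M MP] := homotopy_roots_bounded.
pose z i t : C^o := nth 0 (croots (f t)) i.
have zr i t : (i < n)%N -> z i t \in croots (f t).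
  by move=> ilt; rewrite mem_nth// size_homotopy_roots.
have /choice[al alP] : forall i : nat, exists w : C^o, (i < n)%N -> z i @ U --> w.
  move=> i; have [ilt|] := ltnP i n; last by move=> _; exists 0.
  have := @compact_square R M; rewrite compact_ultra.
  move=> /(_ (z i @ U) (ultra_fmap _ UU))[].
    have sub : setT `<=` z i @^-1` square M by move=> t _; exact: MP (zr i t ilt).
    exact: filterS sub filterT.
  by move=> w [_ ?]; exists w.
pose s := mkseq al n.
have cc : cvgC U (fun t => (unitclamp t)%:C%C) (unitclamp t0)%:C%C.
  move=> B /nbhs_cabsP[d d0 dB].
  have /cvgrPdist_lt/(_ _ d0) := cvg_trans (cvg_app unitclamp Ut0) (unitclamp_continuous (x:=t0)).
  by apply: filterS => t td; apply: dB; rewrite -rmorphB cabs_real distrC.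
have fE : f t0 = lead t0 *: \prod_(w <- s) ('X - w%:P).
  apply: poly_eq_values => w.
  have c1 : cvgC U (fun t => (f t).[w]) (f t0).[w].
    under eq_fun do rewrite hornerD hornerZ.
    rewrite hornerD hornerZ.
    by apply: cvgC_add; [exact: cvgC_cst | apply: cvgC_mul; [exact: cc | exact: cvgC_cst]].
  have c2 : cvgC U (fun t => (f t).[w]) (lead t0 *: \prod_(w <- s) ('X - w%:P)).[w].
    have -> : (fun t => (f t).[w]) =
        (fun t => lead t * \prod_(i < n) (w - z i t)).
      apply/funext => t; rewrite [in LHS]homotopyE hornerZ horner_prod.
      rewrite (big_nth 0) size_homotopy_roots big_mkord; congr (_ * _).
      by apply: eq_bigr => i _; rewrite !hornerE.
    rewrite hornerZ horner_prod big_mkseq.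
    apply: cvgC_mul; first by apply: cvgC_add; [exact: cvgC_cst | exact: cc].
    under eq_bigr do rewrite !hornerE.
    apply: (@cvgC_prod _ _ _ n (fun i t => w - z i t) (fun i => w - al i)) => i ilt.
    by apply: cvgC_add; [exact: cvgC_cst | apply: cvgC_opp; exact: alP].
  exact: (cvgC_unique _ c1 c2).
have ps : perm_eq (croots (f t0)) s.
  apply: prod_XsubC_eq.
  by apply: (scalerI (lead_neq0 t0)); rewrite -homotopyE.
have FE : F t0 = \sum_(i < n) psi (al i).
  by rewrite /F (perm_big _ ps) big_mkseq.
have UA : U A.
  have : U [set t | forall i : 'I_n, psi (z i t) = psi (al i)].
    apply: filter_forall => i.
    have [|d d0 dP] := psiP (z := al i).
      apply: (@homotopy_root_le t0); rewrite (perm_mem ps); apply: map_f.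
      by rewrite mem_iota /=.
    have Ud : (z i @ U) [set w | cabs (w - al i) < d].
      by apply: alP => //; apply/nbhs_cabsP; exists d.
    have sub : [set t | cabs (z i t - al i) < d] `<=` [set t | psi (z i t) = psi (al i)].
      by move=> t; exact: dP.
    exact: filterS sub Ud.
  apply: filterS => t /= H; rewrite /A /= FE /F (big_nth 0) size_homotopy_roots big_mkord.
  by apply: eq_bigr => i _; exact: H.
by have [t []] := @filter_ex _ _ UF _ (filterI UA UnA).
Qed.

(** A substitute for Rouche's theorem that treats all cells of a grid at once.  A
    root of [p + t q] satisfies [|p| <= |q|], so [psi] is locally constant at it
    and the sum of [psi] over the roots cannot vary with [t]. *)
Lemma root_sum_eq : \sum_(z <- a) psi z = \sum_(z <- croots (p + q)) psi z.
Proof.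
have F01 : F 0 = F 1.
  apply: (@is_derive_0_is_cst R F 0 1) => t.
  apply: (@near_eq_is_derive _ _ _ (cst (F t))) => //.
  by have := root_sum_locally_const t; apply: filterS => s ->.
have f1 : f 1 = p + q.
  by rewrite /f /homotopy /unitclamp minxx (max_idPr ler01) scale1r.
have f0 : f 0 = p.
  by rewrite /f /homotopy /unitclamp (min_idPl ler01) maxxx scale0r addr0.
rewrite -f1 -/(F 1) -F01 /F f0; apply: perm_big.
apply: prod_XsubC_eq.
have := crootsE p; have /monicP := monic_prod_XsubC a xpredT id.
by rewrite -/p => -> ; rewrite scale1r => <-.
Qed.

End Homotopy.
End RootHomotopy.

(** * Perturbed grids on the real line *)

Section PerturbedGrid.
Variable R : realType.
Variables (e : R) (g : int -> R).
Hypothesis e_gt0 : 0 < e.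
Hypothesis gP : forall i, i%:~R * e <= g i <= i%:~R * e + e / 2.

Lemma grid_homo i j : i < j -> g i < g j.
Proof.
rewrite -lezD1 => ij; have /andP[_ gi] := gP i; have /andP[gj _] := gP j.
have : (i + 1)%:~R * e <= j%:~R * e by rewrite ler_pM2r// ler_int.
rewrite intrD mulrDl mul1r => ij1; have := e_gt0; lra.
Qed.

(** The line [g i] lies in the first half of its slot, so the slot of [x] or the
    preceding one works. *)
Lemma grid_cell x : exists i, [/\ g i <= x, x < g (i + 1) & x - g i < 2 * e].
Proof.
pose i := Num.floor (x / e).
have /andP[] := floor_itv (x / e); rewrite -/i ler_pdivlMr// ltr_pdivrMr//.
rewrite intrD mulrDl mul1r => ix xi.
have /andP[gi gi'] := gP i; have [xg|gx] := ltP x (g i); last first.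
  have /andP[+ _] := gP (i + 1); rewrite intrD mulrDl mul1r => gi1.
  by exists i; split => //; lra.
have /andP[] := gP (i - 1); rewrite intrB mulrBl mul1r => gi1 gi1'.
by exists (i - 1); rewrite subrK; split => //; lra.
Qed.

Definition cell x : int := sval (cid (grid_cell x)).

Lemma cellP x : [/\ g (cell x) <= x, x < g (cell x + 1) & x - g (cell x) < 2 * e].
Proof. by rewrite /cell; case: cid. Qed.

Lemma cell_locally_const x : (forall i, x <> g i) ->
  exists2 d, 0 < d & forall y, `|y - x| < d -> cell y = cell x.
Proof.
move=> xg; have [gx xg1 _] := cellP x.
have gx' : g (cell x) < x by rewrite lt_neqAle gx andbT; apply/eqP => /esym/xg.
exists (Num.min (x - g (cell x)) (g (cell x + 1) - x)).
  by rewrite lt_min !subr_gt0 gx'.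
move=> y; rewrite lt_min !ltr_norml => /andP[/andP[y1 _] /andP[_ y2]].
have [gy yg1 _] := cellP y.
have mono i j : i + 1 <= j -> g (i + 1) <= g j.
  by rewrite le_eqVlt => /predU1P[->//|/grid_homo/ltW].
have [xy|yx|//] := ltgtP (cell x) (cell y).
- by move: xy; rewrite -lezD1 => /mono gg; exfalso; lra.
- by move: yx; rewrite -lezD1 => /mono gg; exfalso; lra.
Qed.

End PerturbedGrid.

(** * Bounding polynomials by their Mahler measure *)

Lemma prodr_const_seq (V : comPzRingType) (I : Type) (s : seq I) (x : V) :
  \prod_(i <- s) x = x ^+ size s.
Proof. by rewrite big_const_seq count_predT iter_mulr mulr1. Qed.

Section Comparison.
Variable R : realType.
Local Notation C := R[i].
Implicit Types (a b : seq C) (z w : C).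

Definition mahler_prod a : R := \prod_(z <- a) Num.max (cabs z) 1.

Lemma mahler_prod_gt0 a : 0 < mahler_prod a.
Proof. by apply: prodr_gt0 => z _; rewrite lt_max ltr01 orbT. Qed.

Lemma cabs_horner_prod a z :
  cabs (\prod_(w <- a) ('X - w%:P)).[z] = \prod_(w <- a) cabs (z - w).
Proof. by rewrite horner_prod cabs_prod; under eq_bigr do rewrite !hornerE. Qed.

(** Each factor satisfies |z - w| <= (1 + K) max(|w|, 1). *)
Lemma horner_upper b K z : 0 <= K -> cabs z <= K ->
  cabs (\prod_(w <- b) ('X - w%:P)).[z] <= (1 + K) ^+ size b * mahler_prod b.
Proof.
move=> K0 zK; rewrite cabs_horner_prod /mahler_prod -(prodr_const_seq b (1 + K)).
rewrite -big_split; apply: ler_prod => w _; rewrite cabs_ge0 /=.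
rewrite (le_trans (cabsD _ _))// cabsN mulrDl mul1r addrC lerD//.
  by rewrite le_max lexx.
by rewrite (le_trans zK)// ler_peMr// le_max lexx orbT.
Qed.

(** Roots with |w| > 2K are at distance at least |w| / 2 from the disc.  For the
    other ones |z - w| is bounded below by the difference of the projections [f],
    the real or imaginary part, and [monic_large_value] chooses the line. *)
Lemma horner_lower (f : C -> R) (fN : forall z w, `|f z - f w| <= cabs (z - w))
    a K h x0 : 1 <= K -> 0 < h -> h <= 1 ->
  exists x, [/\ x0 <= x, x <= x0 + h & forall z, f z = x -> cabs z <= K ->
    (h / (4 * K * expR 1)) ^+ size a * mahler_prod a <=
      cabs (\prod_(w <- a) ('X - w%:P)).[z]].
Proof.
move=> K1 h0 h1; pose s := [seq f w | w <- a & cabs w <= 2 * K].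
have [x [x0x xx0 xs]] := monic_large_value s x0 (ltW h0).
exists x; split => // z fz zK; rewrite cabs_horner_prod /mahler_prod.
have e1 : 1 <= expR 1 :> R by rewrite (le_trans _ (expR_ge1Dx 1))// lerDl.
set k := h / _.
have k0 : 0 <= k by rewrite divr_ge0// ?ltW// !mulr_gt0//; lra.
have k12 : k <= 1 / 2.
  rewrite /k ler_pdivrMr; last by rewrite !mulr_gt0//; lra.
  have Ke : 1 <= K * expR 1 by rewrite -[leLHS]mulr1 ler_pM.
  lra.
rewrite -(prodr_const_seq a k) -big_split /=.
rewrite (bigID (fun w => cabs w <= 2 * K)) [leRHS](bigID (fun w => cabs w <= 2 * K)) /=.
have max0 w : 0 <= Num.max (cabs w) 1 by rewrite le_max ler01 orbT.
apply: ler_pM; [by rewrite prodr_ge0// => w _; rewrite mulr_ge0| |  |].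
- by rewrite prodr_ge0// => w _; rewrite mulr_ge0.
- apply: (@le_trans _ _ (\prod_(u <- s) `|x - u|)); last first.
    rewrite /s big_map big_filter; apply: ler_prod => w _.
    by rewrite normr_ge0 -fz fN.
  apply: le_trans xs; rewrite -prodr_const_seq /s big_map big_filter.
  apply: ler_prod => w wK; rewrite mulr_ge0//=.
  rewrite (@le_trans _ _ (k * (2 * K)))//.
    by rewrite ler_wpM2l// ge_max wK; lra.
  by rewrite /k le_eqVlt; apply/orP; left; apply/eqP; field; apply/andP; split; lra.
- apply: ler_prod => w; rewrite -ltNge mulr_ge0//= => wK.
  have wz : cabs w <= cabs (z - w) + cabs z.
    by rewrite cabsC (le_trans _ (cabsD _ _))// subrK.
  rewrite (@le_trans _ _ (1 / 2 * Num.max (cabs w) 1))//.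
    by rewrite ler_wpM2r.
  have -> : Num.max (cabs w) 1 = cabs w by apply/max_idPl; lra.
  lra.
Qed.

End Comparison.

(** * Comparing the roots of p and of p + q *)

Section EmpiricalComparison.
Variable R : realType.
Local Notation C := R[i].
Implicit Types (a b : seq C) (z w : C).

(** The threshold [Lam] for the gap of the Mahler measures is per unit of degree and
    does not depend on the degree.  The last sum bounds the number of roots of [p]
    outside a finite union of cells; it also bounds that of [p + q], because the
    indicator function of this union is itself constant on cells. *)
Lemma root_sum_close (phi : C -> R) (B eta L : R) :
  (forall z, cont_at phi z) -> (forall z, `|phi z| <= B) -> 0 < eta -> 0 <= L ->
  exists Lam, forall a b, size b = size a ->
    (size a)%:R * Lam < ln (mahler_prod a) - ln (mahler_prod b) ->
    `|\sum_(z <- a) phi z -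
      \sum_(z <- croots (\prod_(w <- a) ('X - w%:P) + \prod_(w <- b) ('X - w%:P))) phi z|
    <= 2 * (size a)%:R * eta + 2 * B * \sum_(z <- a) (L < cabs z)%R%:R.
Proof.
(* Points move by less than 1 to the corner of their cell: the kept cells, whose
   corner has modulus at most [L1], cover the disc of radius [L] and stay at
   distance at least 1 from the complement of the disc of radius [K]. *)
move=> phic phiB eta0 L0; pose L1 := L + 1; pose K := L1 + 2.
have K1 : 1 <= K by rewrite /K /L1; lra.
have [d d0 phiu] := cont_uniform K phic eta0.
(* Each coordinate moves by less than [2 e], hence a point by less than [4 e]. *)
pose e := Num.min (d / 4) (1 / 4).
have e0 : 0 < e by rewrite lt_min !divr_gt0.
have [ed e1] : e <= d / 4 /\ e <= 1 / 4 by rewrite /e !ge_min !lexx orbT.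
pose h := e / 2; have h0 : 0 < h by rewrite divr_gt0.
have h1 : h <= 1 by rewrite /h; lra.
pose k := h / (4 * K * expR 1).
have k0 : 0 < k by rewrite divr_gt0// !mulr_gt0// ?expR_gt0//; lra.
exists (ln ((1 + K) / k)) => a b ab; set n := size a => lnab.
set p := \prod_(w <- a) _; set q := \prod_(w <- b) _.
have Mlt : (1 + K) ^+ n * mahler_prod b < k ^+ n * mahler_prod a.
  have Ma := mahler_prod_gt0 a; have Mb := mahler_prod_gt0 b.
  have K10 : 0 < 1 + K by lra.
  rewrite -ltr_ln ?posrE ?mulr_gt0 ?exprn_gt0// !lnM ?posrE ?exprn_gt0//.
  rewrite !lnXn// -[ln (1 + K) *+ n]mulr_natl -[ln k *+ n]mulr_natl.
  by move: lnab; rewrite ln_div ?posrE// mulrBr; lra.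
have good (f : C -> R) : (forall z w, `|f z - f w| <= cabs (z - w)) ->
    exists g : int -> R, forall i, i%:~R * e <= g i <= i%:~R * e + e / 2 /\
      forall z, f z = g i -> cabs z <= K -> cabs q.[z] < cabs p.[z].
  move=> fN; have /choice[g gP] := fun i : int =>
    horner_lower fN a (i%:~R * e) K1 h0 h1.
  exists g => i; have [g1 g2 g3] := gP i; split; first by rewrite g1 g2.
  move=> z fz zK; apply: lt_le_trans (g3 z fz zK); apply: le_lt_trans Mlt.
  by rewrite /n -ab; apply: horner_upper => //; lra.
have ReN z w : `|Re z - Re w| <= cabs (z - w).
  by have [+ _ _] := cabs_ReIm (z - w); rewrite ReB.
have ImN z w : `|Im z - Im w| <= cabs (z - w).
  by have [_ + _] := cabs_ReIm (z - w); rewrite ImB.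
have [g gP] := good _ ReN; have [g' g'P] := good _ ImN.
have gP1 i := (gP i).1; have g'P1 i := (g'P i).1.
pose c z : C := Complex (g (cell e0 gP1 (Re z))) (g' (cell e0 g'P1 (Im z))).
have cz z : cabs (z - c z) < 4 * e.
  have [_ _ /le_lt_trans->//] := cabs_ReIm (z - c z); rewrite ReB ImB /=.
  have [x1 x2 x3] := cellP e0 gP1 (Re z); have [y1 y2 y3] := cellP e0 g'P1 (Im z).
  by rewrite !ger0_norm ?subr_ge0//; lra.
have e41 : 4 * e <= 1 by lra.
pose T z := cabs (c z) <= L1.
pose step (H : C -> R) z := if T z then H (c z) else 0.
have stepE H : \sum_(z <- a) step H z = \sum_(z <- croots (p + q)) step H z.
  apply: (@root_sum_eq _ a b n) => // z pq.
  have [zK|Kz] := leP (cabs z) K; last first.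
    have nT w : cabs (w - z) < 1 -> step H w = 0.
      move=> wz; rewrite /step ifN// /T -ltNge.
      have h2 := cz w; have h3 := cabsD (w - c w) (c w).
      have h4 := cabsD (z - w) w; move: h3 h4.
      rewrite !subrK (cabsC z w) /L1 => h3 h4.
      by move: Kz; rewrite /K /L1; lra.
    exists 1 => // w wz; rewrite (nT w)// (nT z)// subrr cabs0//.
  have [|d1 d10 dg] := @cell_locally_const _ _ _ e0 gP1 (Re z).
    by move=> i zi; have := (gP i).2 z zi zK; rewrite ltNge pq.
  have [|d2 d20 dg'] := @cell_locally_const _ _ _ e0 g'P1 (Im z).
    by move=> i zi; have := (g'P i).2 z zi zK; rewrite ltNge pq.
  exists (Num.min d1 d2); first by rewrite lt_min d10.
  move=> w; rewrite lt_min => /andP[wd1 wd2].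
  suff E : c w = c z by rewrite /step /T E.
  rewrite /c dg ?dg'//; first exact: le_lt_trans (ImN _ _) wd2.
  exact: le_lt_trans (ReN _ _) wd1.
have B0 : 0 <= B by rewrite (le_trans _ (phiB 0)).
pose out z := 1 - step (cst 1) z.
have phi_step z : `|phi z - step phi z| <= eta + B * out z.
  rewrite /out /step; case: ifPn => Tz; last first.
    by rewrite !subr0 mulr1 (le_trans (phiB z))// lerDr ltW.
  rewrite subrr mulr0 addr0 ltW// phiu//.
    by rewrite (le_trans Tz)// /K lerDl.
  by rewrite (lt_le_trans (cz z))//; lra.
have phi_step_sum s : `|\sum_(z <- s) phi z - \sum_(z <- s) step phi z| <=
    (size s)%:R * eta + B * \sum_(z <- s) out z.
  rewrite -sumrB (le_trans (ler_norm_sum _ _ _))//.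
  rewrite (le_trans (ler_sum _ (fun z _ => phi_step z)))//.
  by rewrite big_split /= -mulr_sumr big_const_seq count_predT iter_addr_0 mulr_natl.
have szr : size (croots (p + q)) = n.
  have -> : p + q = homotopy p q 1.
    by rewrite /homotopy /unitclamp minxx (max_idPr ler01) scale1r.
  exact: size_homotopy_roots.
(* [out] is 1 minus a function constant on cells, hence has the same sums. *)
have outE : \sum_(z <- croots (p + q)) out z = \sum_(z <- a) out z.
  rewrite !sumrB -stepE; congr (_ - _).
  by rewrite !big_const_seq !count_predT szr.
have out_le : \sum_(z <- a) out z <= \sum_(z <- a) (L < cabs z)%R%:R.
  apply: ler_sum => z _; rewrite /out /step; case: ifPn => Tz.
    by rewrite subrr ler0n.
  rewrite subr0; have -> // : L < cabs z.
  have h2 := cz z; have := cabsD (c z - z) z; rewrite subrK cabsC => h3.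
  by move: Tz; rewrite /T -ltNge /L1; lra.
have h1' := phi_step_sum a; have h2' := phi_step_sum (croots (p + q)).
move: h1' h2'; rewrite outE szr stepE -/n !ler_norml => /andP[? ?] /andP[? ?].
have Bout : B * \sum_(z <- a) out z <= B * \sum_(z <- a) (L < cabs z)%R%:R.
  by rewrite ler_wpM2l.
by apply/andP; split; lra.
Qed.

End EmpiricalComparison.

(** * Integrals of bounded functions *)

Section BoundedIntegrals.
Context d (T : measurableType d) (R : realType) (P : probability T R).
Implicit Types (h : T -> R) (c : R).
Local Notation integ h := (P.-integrable setT (EFin \o (h : T -> R))).
Local Notation I h := (\int[P]_z (h : T -> R) z).

Lemma integ_bounded h c : measurable_fun setT h ->
  (forall z, `|h z| <= c) -> integ h.
Proof.
move=> mh hB; have PT : (P setT < +oo)%E by rewrite probability_setT ltry.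
apply: measurable_bounded_integrable => //.
by exists c; split; [exact: num_real | move=> x Bx z _ /=; rewrite (le_trans (hB z))// ltW].
Qed.

Lemma integD h h' : integ h -> integ h' -> integ (fun z => h z + h' z).
Proof. by move=> ih ih'; exact: (integrableD measurableT ih ih'). Qed.

Lemma integZ c h : integ h -> integ (fun z => c * h z).
Proof. by move=> ih; exact: (integrableZl measurableT c ih). Qed.

Lemma integ_cst c : integ (fun=> c).
Proof. exact: (@integ_bounded _ `|c|). Qed.

Lemma Rintegral_cst_probability c : I (fun=> c) = c.
Proof.
transitivity (c * fine (P setT)); first exact: Rintegral_cst.
by rewrite probability_setT mulr1.
Qed.

Lemma integ_sum N (h : nat -> T -> R) : (forall k, integ (h k)) ->
  integ (fun z => \sum_(k < N) h k z).
Proof.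
move=> ih; elim: N => [|N IH].
  by under eq_fun do rewrite big_ord0; exact: integ_cst.
by under eq_fun do rewrite big_ord_recr; exact: integD.
Qed.

Lemma integral_sum N (h : nat -> T -> R) : (forall k, integ (h k)) ->
  I (fun z => \sum_(k < N) h k z) = \sum_(k < N) I (h k).
Proof.
move=> ih; elim: N => [|N IH].
  by under eq_Rintegral do rewrite big_ord0; rewrite big_ord0 Rintegral_cst_probability.
under eq_Rintegral do rewrite big_ord_recr.
by rewrite RintegralD//; [rewrite IH big_ord_recr | exact: integ_sum].
Qed.

Lemma integral_indicator (A : set T) : measurable A -> I (\1_A) = fine (P A).
Proof. by move=> mA; rewrite /Rintegral integral_indic// setIT. Qed.

End BoundedIntegrals.

(** * Square cells of the plane *)

Section Cells.
Variable R : realType.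
Local Notation C := R[i].
Implicit Types (z w : C) (m k N : nat).

(** Cells of side [1 / m.+1] are numbered by natural numbers, so that finite unions
    of cells are initial segments and step functions are sums over ordinals. *)
Definition cell_index m z : nat :=
  choice.pickle (Num.floor (m.+1%:R * Re z), Num.floor (m.+1%:R * Im z)).

Definition cell_corner m k : C :=
  if choice.unpickle k is Some (i, j) then
    Complex ((i : int)%:~R / m.+1%:R) ((j : int)%:~R / m.+1%:R)
  else 0.

Lemma cell_corner_close m z : cabs (cell_corner m (cell_index m z) - z) <= 2 / m.+1%:R.
Proof.
have m0 : 0 < m.+1%:R :> R by rewrite ltr0n.
have close1 (x : R) : `|(Num.floor (m.+1%:R * x))%:~R / m.+1%:R - x| <= 1 / m.+1%:R.
  have /andP[] := floor_itv (m.+1%:R * x); set i := Num.floor _; rewrite intrD => h1 h2.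
  have -> : i%:~R / m.+1%:R - x = (i%:~R - m.+1%:R * x) / m.+1%:R.
    by field; rewrite gt_eqF.
  rewrite normrM (@gtr0_norm _ (m.+1%:R^-1)) ?invr_gt0//.
  apply: ler_wpM2r; first by rewrite invr_ge0 ltW.
  by rewrite ler_norml; apply/andP; split; lra.
rewrite /cell_index /cell_corner choice.pickleK.
have [_ _ /le_trans->//] := cabs_ReIm (Complex ((Num.floor (m.+1%:R * Re z))%:~R / m.+1%:R)
  ((Num.floor (m.+1%:R * Im z))%:~R / m.+1%:R) - z).
by rewrite ReB ImB /= (le_trans (lerD (close1 _) (close1 _)))// -mulrDl.
Qed.

(** Each cell is close to its corner, and there are finitely many corners. *)
Lemma cells_bounded m N : exists2 L, 0 <= L &
  forall z, (cell_index m z < N)%N -> cabs z <= L.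
Proof.
exists (\sum_(k < N) cabs (cell_corner m k) + 2 / m.+1%:R).
  by rewrite addr_ge0 ?divr_ge0// sumr_ge0// => k _; exact: cabs_ge0.
move=> z zN; have -> : z = cell_corner m (cell_index m z) +
    (z - cell_corner m (cell_index m z)) by rewrite addrC subrK.
rewrite (le_trans (cabsD _ _))// lerD//.
  rewrite (bigD1 (Ordinal zN))// lerDl sumr_ge0// => k _; exact: cabs_ge0.
by rewrite cabsC cell_corner_close.
Qed.

Lemma cont_at_open (f : C -> R) (A : set R) : (forall z, cont_at f z) -> open A ->
  open (f @^-1` A : set C^o).
Proof.
move=> fc; rewrite !openE => Ao z /Ao /nbhs_ballP[e /= e0 eA].
have [d d0 dP] := fc z e e0; apply/nbhs_cabsP; exists d => // w /dP fwz.
by apply: eA; rewrite /ball /= distrC.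
Qed.

Lemma cont_measurable (f : C -> R) : (forall z, cont_at f z) ->
  measurable_fun setT (f : borelC R -> R).
Proof.
move=> fc; apply: (measurability _ (RGenOpens.measurableE R)) => //.
move=> _ [_ [x [y ->] <-]]; rewrite setTI; apply: sub_sigma_algebra.
by apply: cont_at_open => //; exact: itv_open.
Qed.

Lemma Re_cont z : cont_at (@complex.Re R) z.
Proof.
move=> e e0; exists e => // w; apply: le_lt_trans.
by have [+ _ _] := cabs_ReIm (w - z); rewrite ReB.
Qed.

Lemma Im_cont z : cont_at (@complex.Im R) z.
Proof.
move=> e e0; exists e => // w; apply: le_lt_trans.
by have [_ + _] := cabs_ReIm (w - z); rewrite ImB.
Qed.

Definition cell_set m k : set (borelC R) := [set z | cell_index m z = k].

Lemma measurable_floor_eq (f : C -> R) m (i : int) : (forall z, cont_at f z) ->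
  measurable ([set z | Num.floor (m.+1%:R * f z) = i] : set (borelC R)).
Proof.
move=> fc.
have m0 : 0 < m.+1%:R :> R by rewrite ltr0n.
have -> : [set z | Num.floor (m.+1%:R * f z) = i] =
    f @^-1` `[i%:~R / m.+1%:R, (i + 1)%:~R / m.+1%:R[%classic.
  apply/seteqP; split=> z /=; rewrite in_itv /= ler_pdivrMr// ltr_pdivlMr//.
    by move=> /eqP; rewrite floor_eq ![_%:R * f z]mulrC.
  by rewrite ![f z * _]mulrC => h; apply/eqP; rewrite floor_eq.
rewrite -[X in measurable X]setTI; exact: cont_measurable.
Qed.

(** Some numbers [k] are not the code of a pair of integers, and then the cell is
    empty. *)
Lemma measurable_cell m k : measurable (cell_set m k).
Proof.
have [[[i j] ij]|nk] := pselect (exists ij : int * int, choice.pickle ij = k); last first.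
  have -> : cell_set m k = set0.
    apply/seteqP; split => // z zk; apply: nk.
    by exists (Num.floor (m.+1%:R * Re z), Num.floor (m.+1%:R * Im z)).
  exact: measurable0.
have -> : cell_set m k = [set z | Num.floor (m.+1%:R * Re z) = i] `&`
    [set z | Num.floor (m.+1%:R * Im z) = j].
  rewrite /cell_set -ij /cell_index; apply/seteqP; split => z /=.
    by move=> /(pcan_inj choice.pickleK)[-> ->].
  by move=> [-> ->].
by apply: measurableI; apply: measurable_floor_eq; [exact: Re_cont|exact: Im_cont].
Qed.

End Cells.

(** * Weak convergence from the frequencies of cells *)

Section EmpiricalAverages.
Variable R : realType.
Local Notation C := R[i].
Implicit Types (z w : C) (m k N : nat) (s : seq C) (h : C -> R).

(** The value 0 on the empty sequence is why the average of a constant is only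
    bounded by it in [avg_cst_le]. *)
Definition avg s h : R := (size s)%:R^-1 * \sum_(z <- s) h z.

Lemma avgD s h h' : avg s (fun z => h z + h' z) = avg s h + avg s h'.
Proof. by rewrite /avg big_split mulrDr. Qed.

Lemma avgZ s c h : avg s (fun z => c * h z) = c * avg s h.
Proof. by rewrite /avg -mulr_sumr mulrCA. Qed.

Lemma avg_sum s N (h : nat -> C -> R) :
  avg s (fun z => \sum_(k < N) h k z) = \sum_(k < N) avg s (h k).
Proof. by rewrite /avg exchange_big mulr_sumr. Qed.

Lemma le_avg s h h' : (forall z, h z <= h' z) -> avg s h <= avg s h'.
Proof.
by move=> hh'; rewrite /avg ler_wpM2l ?invr_ge0//; apply: ler_sum => z _.
Qed.

Lemma ler_norm_avg s h : `|avg s h| <= avg s (fun z => `|h z|).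
Proof.
rewrite /avg normrM ger0_norm ?invr_ge0// ler_wpM2l ?invr_ge0//.
exact: ler_norm_sum.
Qed.

Lemma avg_cst_le s c : 0 <= c -> avg s (fun=> c) <= c.
Proof.
move=> c0; rewrite /avg big_const_seq count_predT iter_addr_0 -[c *+ _]mulr_natl mulrA.
have [->|s0] := eqVneq (size s) 0%N; first by rewrite mulr0 mul0r.
by rewrite mulVf ?mul1r// pnatr_eq0.
Qed.

Definition stepf m N (v : nat -> R) z : R :=
  \sum_(k < N) v k * (cell_index m z == k)%:R.

Lemma stepfE m N v z :
  stepf m N v z = if (cell_index m z < N)%N then v (cell_index m z) else 0.
Proof.
rewrite /stepf; case: ifPn => [zN|]; last first.
  rewrite -leqNgt => Nz; rewrite big1// => k _; case: eqVneq => [e|]; rewrite ?mulr0//.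
  by move: Nz; rewrite e leqNgt ltn_ord.
rewrite (bigD1 (Ordinal zN))//= eqxx mulr1 big1 ?addr0// => k.
by rewrite eq_sym -val_eqE /= => /negbTE->; rewrite mulr0.
Qed.

Definition covered m N z : R := stepf m N (fun=> 1) z.

Lemma coveredE m N z : covered m N z = (cell_index m z < N)%:R.
Proof. by rewrite /covered stepfE; case: ifP. Qed.

Variable mu : probability (borelC R) R.
Local Notation integ h := (mu.-integrable setT (EFin \o (h : borelC R -> R))).
Local Notation I h := (\int[mu]_z (h : borelC R -> R) z).

Lemma cell_indicE m k :
  (fun z => (cell_index m z == k)%:R) = (\1_(cell_set m k) : borelC R -> R).
Proof.
apply/funext => z; rewrite indicE; congr (nat_of_bool _)%:R.
by apply/eqP/idP => [?|]; rewrite inE.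
Qed.

Lemma integ_cell_indic m k : integ (fun z => (cell_index m z == k)%:R).
Proof.
rewrite cell_indicE; apply: (@integ_bounded _ _ _ _ _ 1).
  by apply: measurable_indic; exact: measurable_cell.
by move=> z; rewrite indicE normr_nat lern1 leq_b1.
Qed.

Lemma integ_stepf m N v : integ (stepf m N v).
Proof.
apply: (@integ_sum _ _ _ mu N (fun k z => v k * (cell_index m z == k)%:R)) => k.
by apply: integZ; exact: integ_cell_indic.
Qed.

Lemma integral_stepf m N v :
  I (stepf m N v) = \sum_(k < N) v k * fine (mu (cell_set m k)).
Proof.
rewrite (@integral_sum _ _ _ mu N (fun k z => v k * (cell_index m z == k)%:R)) =>
    [|k]; last by apply: integZ; exact: integ_cell_indic.
apply: eq_bigr => k _; rewrite RintegralZl//; last exact: integ_cell_indic.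
by rewrite -integral_indicator ?cell_indicE//; exact: measurable_cell.
Qed.

(** Continuity from below of [mu], as the cells exhaust the plane. *)
Lemma covered_full m (eta : R) : 0 < eta ->
  exists N, 1 - eta < I (covered m N).
Proof.
move=> eta0; pose F N : set (borelC R) := [set z | (cell_index m z < N)%N].
have FE N : \1_(F N) = (covered m N : borelC R -> R).
  by apply/funext => z; rewrite indicE coveredE; congr (nat_of_bool _)%:R; apply/idP/idP; rewrite inE.
have mF N : measurable (F N).
  have -> : F N = \big[setU/set0]_(k < N) (cell_set m k : set (borelC R)).
    apply/seteqP; split => z; rewrite -bigcup_mkord.
      by move=> zN; exists (cell_index m z).
    by move=> [k kN /= zk]; rewrite /F /= zk.
  by apply: bigsetU_measurable => k _; exact: measurable_cell.
have UF : \bigcup_N F N = setT.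
  by apply/seteqP; split => // z _; exists (cell_index m z).+1 => //=; exact: ltnSn.
have ndF : nondecreasing_seq F.
  by move=> i j ij; apply/subsetPset => z /= /leq_trans; exact.
have : mu (F N) @[N --> \oo] --> 1%E.
  rewrite -(probability_setT mu) -UF.
  by apply: nondecreasing_cvg_mu => //; rewrite UF; exact: measurableT.
move=> /fine_cvgP[_] /cvgrPdist_lt /(_ _ eta0).
move=> [N _ /(_ N (leqnn N))] /=; rewrite ltr_norml => /andP[_ h]; exists N.
suff -> : I (covered m N) = fine (mu (F N)) by lra.
by rewrite -integral_indicator// FE.
Qed.

(** Convergence of the frequencies of countably many cells: a condition that is
    almost sure as soon as each of its instances is, unlike weak convergence. *)
Definition equidistributed (a : nat -> C) : Prop := forall m k,
  avg (mkseq a n) (fun z => (cell_index m z == k)%:R) @[n --> \oo] -->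
    fine (mu (cell_set m k)).

Variable a : nat -> C.
Hypothesis aP : equidistributed a.

Lemma avg_stepf_cvg m N v :
  avg (mkseq a n) (stepf m N v) @[n --> \oo] --> I (stepf m N v).
Proof.
rewrite integral_stepf.
have -> : (fun n => avg (mkseq a n) (stepf m N v)) = (fun n => \sum_(k < N)
    v k * avg (mkseq a n) (fun z => (cell_index m z == k)%:R)).
  apply/funext => n; rewrite /stepf.
  rewrite (avg_sum _ N (fun k z => v k * (cell_index m z == k)%:R)).
  by apply: eq_bigr => k _; rewrite avgZ.
elim: N => [|N IH].
  by under eq_fun do rewrite big_ord0; rewrite big_ord0; exact: cvg_cst.
under eq_fun do rewrite big_ord_recr; rewrite big_ord_recr /=.
by apply: cvgD => //; apply: cvgM; [exact: cvg_cst | exact: aP].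
Qed.

Lemma avg_covered m (eta : R) : 0 < eta -> exists N, 1 - eta < I (covered m N) /\
  \forall n \near \oo, 1 - eta < avg (mkseq a n) (covered m N).
Proof.
move=> eta0; have [N hN] := covered_full m eta0; exists N; split => //.
have := @avg_stepf_cvg m N (fun=> 1); rewrite -/(covered m N).
by move=> /cvgr_gt; exact.
Qed.

(** Finitely many cells that carry almost all of [mu] also carry almost all of the
    sample, and they lie in a disc. *)
Lemma avg_tight (eta : R) : 0 < eta -> exists2 L, 0 <= L &
  \forall n \near \oo, avg (mkseq a n) (fun z => (L < cabs z)%R%:R) <= eta.
Proof.
move=> eta0; have [N [_ hN]] := avg_covered 0 eta0.
have [L L0 LP] := @cells_bounded R 0 N; exists L => //.
apply: filterS hN => n hn.
have : avg (mkseq a n) (fun z => (L < cabs z)%R%:R) <=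
    avg (mkseq a n) (fun z => 1 + (-1) * covered 0 N z).
  apply: le_avg => z; rewrite coveredE; case: ltnP => [/LP zL|_].
    by rewrite ltNge zL /= mulr1 subrr.
  by rewrite mulr0 addr0 lern1 leq_b1.
rewrite avgD avgZ; have := avg_cst_le (mkseq a n) ler01; lra.
Qed.

(** Cells of size 1 first fix a disc [|z| <= L] that carries almost all the mass;
    uniform continuity on this disc then fixes the mesh [m] of the step function
    that replaces [h], and finitely many cells of that mesh suffice. *)
Lemma avg_cvg h (B : R) : (forall z, cont_at h z) -> (forall z, `|h z| <= B) ->
  avg (mkseq a n) h @[n --> \oo] --> I h.
Proof.
move=> hc hB; have B0 : 0 <= B by rewrite (le_trans _ (hB 0)).
apply/cvgrPdist_le => eps eps0.
(* The two approximation errors are at most [eta + 4 B eta] each. *)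
pose eta := eps / (4 + 8 * B).
have eta0 : 0 < eta by rewrite divr_gt0//; lra.
have epsE : eps = 4 * eta + 8 * (B * eta).
  by rewrite /eta; field; rewrite gt_eqF//; lra.
have [N0 [IN0 avN0]] := avg_covered 0 eta0.
have [L L0 LP] := @cells_bounded R 0 N0.
have [d d0 dP] := cont_uniform L hc eta0.
have [m md] : exists m, 2 / m.+1%:R < d.
  exists (Num.truncn (2 / d)); rewrite ltr_pdivrMr ?ltr0n// mulrC -ltr_pdivrMr//.
  exact: truncnS_gt.
have [N [IN avN]] := avg_covered m eta0.
pose v k := h (cell_corner R m k).
pose G z := eta + (2 * B * (1 - covered 0 N0 z) + 2 * B * (1 - covered m N z)).
have hG z : `|h z - stepf m N v z| <= G z.
  have hv : `|h z - stepf m N v z| <= 2 * B.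
    rewrite (le_trans (ler_normB _ _))// mulr_natl mulr2n lerD// stepfE.
    by case: ifP => _; rewrite ?hB// normr0.
  rewrite /G !coveredE; case: (ltnP _ N0) => z0; case: (ltnP _ N) => zN;
    rewrite ?subrr ?subr0 ?mulr1 ?mulr0 ?addr0 ?add0r.
  - rewrite stepfE zN /v distrC ltW// dP ?LP//.
    by rewrite (le_lt_trans _ md)// cell_corner_close.
  - by rewrite (le_trans hv)// lerDr ltW.
  - by rewrite (le_trans hv)// lerDr ltW.
  - by rewrite (le_trans hv)//; lra.
have mh := cont_measurable hc.
have ih : integ h by exact: integ_bounded mh hB.
have istep := integ_stepf m N v.
have ihs : integ (fun z => h z - stepf m N v z).
  by under eq_fun do rewrite -mulN1r; apply: integD => //; exact: integZ.
have IG : `|I h - I (stepf m N v)| <= eta + 4 * (B * eta).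
  rewrite -RintegralB// (le_trans (le_normr_Rintegral _ _))//.
  pose G' z := (eta + 4 * B) + (- (2 * B)) * (covered 0 N0 z + covered m N z).
  have icov : integ (fun z => covered 0 N0 z + covered m N z).
    by apply: integD; exact: integ_stepf.
  have /le_trans->// : (\int[mu]_z `|h z - stepf m N v z|) <= I G'.
    apply: le_Rintegral => //.
    - exact: (integrable_norm ihs).
    - by apply: integD; [exact: integ_cst | exact: integZ].
    - by move=> z _; rewrite (le_trans (hG z))// /G /G'; lra.
  rewrite RintegralD//; [|exact: integ_cst|exact: integZ].
  rewrite RintegralZl// RintegralD//; [|exact: integ_stepf|exact: integ_stepf].
  rewrite Rintegral_cst_probability.
  have c2 : B * (1 - eta) <= B * I (covered 0 N0) by rewrite ler_wpM2l// ltW.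
  have c3 : B * (1 - eta) <= B * I (covered m N) by rewrite ler_wpM2l// ltW.
  nra.
have AG n : 1 - eta < avg (mkseq a n) (covered 0 N0) ->
    1 - eta < avg (mkseq a n) (covered m N) ->
    `|avg (mkseq a n) h - avg (mkseq a n) (stepf m N v)| <= eta + 4 * (B * eta).
  move=> a0 am.
  have -> : avg (mkseq a n) h - avg (mkseq a n) (stepf m N v) =
      avg (mkseq a n) (fun z => h z + (-1) * stepf m N v z).
    by rewrite avgD avgZ mulN1r.
  rewrite (le_trans (ler_norm_avg _ _))//.
  have /le_trans->// : avg (mkseq a n) (fun z => `|h z + (-1) * stepf m N v z|) <=
      avg (mkseq a n) (fun z => (eta + 4 * B) + (- (2 * B)) * (covered 0 N0 z + covered m N z)).
    apply: le_avg => z; rewrite mulN1r (le_trans (hG z))// /G; lra.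
  rewrite avgD avgZ avgD.
  have c1 : avg (mkseq a n) (fun=> eta + 4 * B) <= eta + 4 * B.
    by apply: avg_cst_le; lra.
  have c2 : B * (1 - eta) <= B * avg (mkseq a n) (covered 0 N0) by rewrite ler_wpM2l// ltW.
  have c3 : B * (1 - eta) <= B * avg (mkseq a n) (covered m N) by rewrite ler_wpM2l// ltW.
  nra.
have := @avg_stepf_cvg m N v => /cvgrPdist_le /(_ _ eta0) avS.
near=> n.
have a0 : 1 - eta < avg (mkseq a n) (covered 0 N0) by near: n.
have am : 1 - eta < avg (mkseq a n) (covered m N) by near: n.
have h1 := AG n a0 am.
have h2 : `|I (stepf m N v) - avg (mkseq a n) (stepf m N v)| <= eta by near: n.
have -> : I h - avg (mkseq a n) h = (I h - I (stepf m N v)) +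
  ((I (stepf m N v) - avg (mkseq a n) (stepf m N v)) -
   (avg (mkseq a n) h - avg (mkseq a n) (stepf m N v))) by ring.
rewrite (le_trans (ler_normD _ _))// epsE.
have := ler_normB (I (stepf m N v) - avg (mkseq a n) (stepf m N v))
  (avg (mkseq a n) h - avg (mkseq a n) (stepf m N v)).
lra.
Unshelve. all: by end_near. Qed.

End EmpiricalAverages.

(** * Weak convergence along one sample path *)

Section DeterministicConvergence.
Variable R : realType.
Local Notation C := R[i].
Implicit Types (z w : C) (s : seq C) (h : C -> R) (a b : nat -> C).

(** The positive and negative parts are treated apart, because integration against
    a sum of measures is additive for nonnegative functions. *)
Lemma integral_empirical s h : measurable_fun setT (h : borelC R -> R) ->
  \int[empirical s]_(w in setT) (h : borelC R -> R) w = avg s h.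
Proof.
move=> mh; have mhE : measurable_fun setT (EFin \o (h : borelC R -> R)) by exact/measurable_EFinP.
have ge0_part (f : borelC R -> \bar R) : measurable_fun setT f -> (forall z, 0 <= f z)%E ->
    (\int[empirical s]_(w in setT) f w =
     ((size s)%:R^-1)%:E * \sum_(j < size s) f (nth 0%R s j))%E.
  move=> mf f0; rewrite /empirical ge0_integral_mscale// ge0_integral_measure_sum//=.
  congr (_ * _)%E; apply: eq_bigr => j _.
  by rewrite integral_dirac// diracT mul1e.
rewrite /Rintegral integralE !ge0_part//; try exact: measurable_funepos; try exact: measurable_funeneg.
rewrite /avg (big_nth 0) big_mkord.
have fineD (F : 'I_(size s) -> R) :
    (\sum_(j < size s) (F j)%:E = (\sum_(j < size s) F j)%:E)%E by rewrite sumEFin.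
under eq_bigr do rewrite funeposE /= -EFin_max.
under [X in (_ - _ * X)%E]eq_bigr do rewrite funenegE /= -EFin_max.
rewrite !fineD -!EFinM -EFinB /= -mulrBr -sumrB; congr (_ * _).
apply: eq_bigr => j _; case: (leP 0 (h _)) => hj.
  by rewrite (max_idPr _) ?subr0// oppr_le0.
by rewrite (max_idPl _) ?opprK ?add0r// oppr_ge0 ltW.
Qed.

(** All estimates are made on real functions, so a test function is replaced by its
    real and imaginary parts. *)
Lemma test_function_parts (phi : C^o -> C^o) : test_function phi ->
  exists B : R, (forall z, cabs (phi z) <= B) /\
    (forall z, cont_at (fun w => Re (phi w)) z) /\ (forall z, cont_at (fun w => Im (phi w)) z).
Proof.
move=> [phic [M [Mreal MP]]].
have phiM z : `|phi z| <= M + 1 by apply: (MP (M + 1)) => //; rewrite ltrDl ltr01.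
exists (Re (M + 1)); split.
  by move=> z; have := phiM z; rewrite cabs_normE lecE => /andP[].
have phid z e : 0 < e -> exists2 d, 0 < d & forall w, cabs (w - z) < d ->
    cabs (phi w - phi z) < e.
  move=> e0; apply/nbhs_cabsP.
  have : nbhs (phi z) [set y | cabs (y - phi z) < e] by apply/nbhs_cabsP; exists e.
  exact: phic.
split=> z e /phid -/(_ z)[d d0 dP]; exists d => // w /dP; apply: le_lt_trans.
  by have [+ _ _] := cabs_ReIm (phi w - phi z); rewrite ReB.
by have [_ + _] := cabs_ReIm (phi w - phi z); rewrite ImB.
Qed.

Lemma cvg_complex (x y : nat -> R) (l r : R) : x @ \oo --> l -> y @ \oo --> r ->
  ((fun n => Complex (x n) (y n)) : nat -> C^o) @ \oo --> (Complex l r : C^o).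
Proof.
move=> xl yr A /nbhs_cabsP[d d0 dA].
have d20 : 0 < d / 2 by rewrite divr_gt0.
have /cvgrPdist_lt /(_ _ d20) xd := xl; have /cvgrPdist_lt /(_ _ d20) yd := yr.
have sub n : `|l - x n| < d / 2 -> `|r - y n| < d / 2 -> A (Complex (x n) (y n)).
  move=> hx hy; apply: dA.
  have [_ _ /le_lt_trans->//] := cabs_ReIm (Complex (x n) (y n) - Complex l r).
  by rewrite ReB ImB /= (distrC (x n)) (distrC (y n)) [ltRHS](splitr d) ltrD.
have nearA : \forall n \near \oo, A (Complex (x n) (y n)).
  by near=> n; apply: sub; near: n; [exact: xd | exact: yd].
exact: nearA.
Unshelve. all: by end_near. Qed.

Lemma croots_prod s : perm_eq (croots (\prod_(w <- s) ('X - w%:P))) s.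
Proof.
apply: prod_XsubC_eq; set p := \prod_(w <- s) _.
have := crootsE p; have /monicP -> : p \is monic by exact: monic_prod_XsubC.
by rewrite scale1r => <-.
Qed.

Lemma mahler_prodE s : mahler (\prod_(w <- s) ('X - w%:P)) = mahler_prod s.
Proof. by rewrite /mahler (perm_big _ (croots_prod s)). Qed.

Definition log_mahler_gap a b n : R :=
  n%:R^-1 * (ln (mahler (\prod_(j < n) ('X - (a j)%:P))) -
             ln (mahler (\prod_(j < n) ('X - (b j)%:P)))).

Definition sum_roots a b n : seq C :=
  croots (\prod_(j < n) ('X - (a j)%:P) + \prod_(j < n) ('X - (b j)%:P)).

Variable mu : probability (borelC R) R.

(** The sequence [k] is arbitrary so as to cover both the full sequence and the
    subsequences of a path on which the gap oscillates. *)
Lemma avg_sum_roots_cvg a b (k : nat -> nat) h (B : R) :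
  equidistributed mu a -> k @ \oo --> \oo ->
  log_mahler_gap a b (k i) @[i --> \oo] --> +oo ->
  (forall z, cont_at h z) -> (forall z, `|h z| <= B) ->
  avg (sum_roots a b (k i)) h @[i --> \oo] --> \int[mu]_z (h : borelC R -> R) z.
Proof.
move=> eqa koo gapoo hc hB; have B0 : 0 <= B by rewrite (le_trans _ (hB 0)).
have := cvg_comp _ _ koo (avg_cvg eqa hc hB) => avga.
rewrite -[X in _ --> X]addr0.
have -> : (fun i => avg (sum_roots a b (k i)) h) =
    (fun i => avg (mkseq a (k i)) h + (avg (sum_roots a b (k i)) h - avg (mkseq a (k i)) h)).
  by apply/funext => i; rewrite addrC subrK.
apply: cvgD => //; apply/cvgr0Pnorm_le => eps eps0.
pose eta := eps / (2 + 2 * B).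
have eta0 : 0 < eta by rewrite divr_gt0//; lra.
have [L L0 tight] := avg_tight eqa eta0.
have [Lam LamP] := root_sum_close hc hB eta0 L0.
have tightk : \forall i \near \oo, avg (mkseq a (k i)) (fun z => (L < cabs z)%R%:R) <= eta.
  exact: (koo _ tight).
have kpos : \forall i \near \oo, (0 < k i)%N.
  exact: (koo _ (nbhs_infty_gt 0)).
have gap : \forall i \near \oo, Lam < log_mahler_gap a b (k i).
  exact: (gapoo _ (nbhs_pinfty_gt (num_real Lam))).
near=> i.
have : (0 < k i)%N by near: i.
have : avg (mkseq a (k i)) (fun z => (L < cabs z)%R%:R) <= eta by near: i.
have : Lam < log_mahler_gap a b (k i) by near: i.
move: (k i) => n g1 t1 n0; have n0' : 0 < n%:R :> R by rewrite ltr0n.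
have sza : size (mkseq a n) = n by rewrite size_mkseq.
have szb : size (mkseq b n) = n by rewrite size_mkseq.
have := LamP (mkseq a n) (mkseq b n); rewrite sza szb => /(_ erefl).
rewrite -!mahler_prodE !(big_mkseq 1 *%R) => LamPn.
have /LamPn : n%:R * Lam < ln (mahler (\prod_(j < n) ('X - (a j)%:P))) -
    ln (mahler (\prod_(j < n) ('X - (b j)%:P))).
  by move: g1; rewrite /log_mahler_gap mulrC ltr_pdivlMr// mulrC.
rewrite distrC -/(sum_roots a b n) => close.
have szr : size (sum_roots a b n) = n.
  rewrite /sum_roots -(big_mkseq _ _ a n (fun w => 'X - w%:P)) -(big_mkseq _ _ b n (fun w => 'X - w%:P)).
  have -> : \prod_(w <- mkseq a n) ('X - w%:P) + \prod_(w <- mkseq b n) ('X - w%:P) =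
     homotopy (\prod_(w <- mkseq a n) ('X - w%:P)) (\prod_(w <- mkseq b n) ('X - w%:P)) 1.
    by rewrite /homotopy /unitclamp minxx (max_idPr ler01) scale1r.
  exact: size_homotopy_roots.
rewrite /avg szr sza -mulrBr normrM ger0_norm ?invr_ge0//.
rewrite mulrC ler_pdivrMr// (le_trans close)//.
have -> : \sum_(z <- mkseq a n) (L < cabs z)%R%:R =
    n%:R * avg (mkseq a n) (fun z => (L < cabs z)%R%:R).
  by rewrite /avg sza mulVKf// gt_eqF.
have -> : eps = (2 + 2 * B) * eta by rewrite /eta; field; rewrite gt_eqF//; lra.
have : 2 * B * (n%:R * avg (mkseq a n) (fun z => (L < cabs z)%R%:R)) <= 2 * B * (n%:R * eta).
  by rewrite ler_wpM2l ?mulr_ge0// ler_wpM2l.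
lra.
Unshelve. all: by end_near. Qed.

Lemma sum_roots_weak_cvg a b (k : nat -> nat) :
  equidistributed mu a -> k @ \oo --> \oo ->
  log_mahler_gap a b (k i) @[i --> \oo] --> +oo ->
  weak_cvg (fun i => empirical (sum_roots a b (k i))) mu.
Proof.
move=> eqa koo gapoo phi /test_function_parts[B [phiB [rec imc]]].
rewrite /integral_cvg /cintegral.
have bound z : `|Re (phi z)| <= B /\ `|Im (phi z)| <= B.
  by have [r i _] := cabs_ReIm (phi z); split; exact: le_trans (phiB z).
have -> : (fun n => Complex
    (\int[empirical (sum_roots a b (k n))]_(w in setT) Re (phi w))
    (\int[empirical (sum_roots a b (k n))]_(w in setT) Im (phi w))) =
  (fun n => Complex (avg (sum_roots a b (k n)) (fun w => Re (phi w)))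
    (avg (sum_roots a b (k n)) (fun w => Im (phi w)))).
  by apply/funext => n; congr Complex; apply: integral_empirical; exact: cont_measurable.
apply: cvg_complex.
  by apply: (avg_sum_roots_cvg eqa koo gapoo rec (B := B)) => z; have [] := bound z.
by apply: (avg_sum_roots_cvg eqa koo gapoo imc (B := B)) => z; have [] := bound z.
Qed.

End DeterministicConvergence.

(** * A strong law of large numbers for events *)

Section SquareInterpolation.
Variable R : realType.

(** Telescoping: 1 / (n + 1)^2 <= 1 / n - 1 / (n + 1). *)
Lemma sum_inv_sqr_le N : \sum_(n < N) (n.+1%:R ^- 2) <= 2 :> R.
Proof.
case: N => [|N]; first by rewrite big_ord0.
suff H : \sum_(n < N.+1) (n.+1%:R ^- 2) <= 2 - N.+1%:R^-1 :> R.
  by apply: le_trans H _; rewrite gerBl invr_ge0.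
elim: N => [|N IH]; first by rewrite big_ord1 expr1n invr1; lra.
rewrite big_ord_recr /=; apply: le_trans (lerD IH (lexx _)) _.
have -> : N.+2%:R = N.+1%:R + 1 :> R by rewrite natr1.
have : 0 < N.+1%:R :> R by rewrite ltr0n.
move: (N.+1%:R) => x x0; have x1 : 0 < x + 1 by lra.
rewrite -subr_ge0.
have -> : 2 - (x + 1)^-1 - (2 - x^-1 + (x + 1) ^- 2) = (x * (x + 1) ^+ 2)^-1.
  by field; rewrite !gt_eqF.
by rewrite invr_ge0 mulr_ge0 ?exprn_ge0// ltW.
Qed.

Lemma sqr_bracket n : (0 < n)%N -> exists k, (k.+1 ^ 2 <= n < k.+2 ^ 2)%N.
Proof.
move=> n0; have ex1 : exists k, (k.+1 ^ 2 <= n)%N by exists 0%N.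
have bd k : (k.+1 ^ 2 <= n)%N -> (k <= n)%N.
  by move=> h; apply: ltnW; apply: leq_trans h; exact: (@leq_pexp2l k.+1 1 2).
have [k kP kmax] := ex_maxnP ex1 bd; exists k; rewrite kP /= ltnNge.
by apply/negP => /kmax; rewrite ltnn.
Qed.

(** Between consecutive squares a monotone sequence is squeezed, and the ratio of
    consecutive squares tends to 1. *)
Lemma cvg_of_squares (s : nat -> R) (p : R) :
  (forall m n, (m <= n)%N -> s m <= s n) -> (forall n, 0 <= s n) ->
  s (k.+1 ^ 2)%N / (k.+1 ^ 2)%:R @[k --> \oo] --> p ->
  s n / n%:R @[n --> \oo] --> p.
Proof.
move=> sm s0 sp; pose r k : R := s (k.+1 ^ 2)%N / (k.+1 ^ 2)%:R.
pose q k : R := 1 + harmonic k.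
have qE k : q k = k.+2%:R / k.+1%:R.
  have : k.+1%:R != 0 :> R by rewrite pnatr_eq0.
  by rewrite /q /harmonic /= -[k.+2%:R]natr1; move: (k.+1%:R) => x x0; field.
have q0 k : 0 < q k by rewrite qE divr_gt0 ?ltr0n.
have q1 : q @ \oo --> (1 : R).
  by rewrite -[X in _ --> X]addr0; apply: cvgD; [exact: cvg_cst | exact: cvg_harmonic].
have rS : r k.+1 @[k --> \oo] --> p by rewrite cvg_shiftS.
have u1 : r k.+1 * (q k * q k) @[k --> \oo] --> p.
  by rewrite -[X in _ --> X]mulr1 -[X in _ * X]mulr1; do 2!apply: cvgM => //.
have l1 : r k / (q k * q k) @[k --> \oo] --> p.
  rewrite -[X in _ --> X]mulr1 -invr1 -[X in _ / X]mulr1.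
  apply: cvgM => //; apply: cvgV; first by rewrite mulr1 oner_eq0.
  exact: cvgM.
apply/cvgrPdist_le => e e0.
have /cvgrPdist_le /(_ _ e0) [K1 _ uK] := u1.
have /cvgrPdist_le /(_ _ e0) [K2 _ lK] := l1.
exists ((maxn K1 K2).+2 ^ 2)%N => // n /= nK.
have n0 : (0 < n)%N by rewrite (leq_trans _ nK)// expn_gt0.
have [k /andP[kn nk]] := sqr_bracket n0.
have : (maxn K1 K2 < k.+1)%N.
  by have := leq_ltn_trans nK nk; rewrite ltn_exp2r// ltnS => /ltnW; rewrite !ltnS.
rewrite ltnS geq_max => /andP[K1k K2k].
have := uK k K1k; have := lK k K2k; rewrite /= !ler_norml => /andP[_ lk] /andP[uk _].
have kk0 : 0 < (k.+1 ^ 2)%:R :> R by rewrite ltr0n expn_gt0.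
have kk1 : 0 < (k.+2 ^ 2)%:R :> R by rewrite ltr0n expn_gt0.
have n0' : 0 < n%:R :> R by rewrite ltr0n.
have qq : q k * q k = (k.+2 ^ 2)%:R / (k.+1 ^ 2)%:R.
  have : k.+1%:R != 0 :> R by rewrite pnatr_eq0.
  by rewrite qE !natrX; move: (k.+1%:R) (k.+2%:R) => x x' x0; field.
have up : s n / n%:R <= r k.+1 * (q k * q k).
  have -> : r k.+1 * (q k * q k) = s (k.+2 ^ 2)%N / (k.+1 ^ 2)%:R.
    by rewrite qq /r; field; rewrite !gt_eqF.
  apply: ler_pM => //.
    by apply: sm; exact: ltnW.
  by rewrite lef_pV2 ?posrE// ler_nat.
have lo : r k / (q k * q k) <= s n / n%:R.
  have -> : r k / (q k * q k) = s (k.+1 ^ 2)%N / (k.+2 ^ 2)%:R.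
    by rewrite qq /r; field; rewrite !gt_eqF.
  apply: ler_pM => //.
    exact: sm.
  by rewrite lef_pV2 ?posrE// ler_nat ltnW.
by apply/andP; split; lra.
Qed.

End SquareInterpolation.

Section EventFrequencies.
Context (R : realType) (d : measure_display) (T : measurableType d).
Context (P : probability T R) (A : nat -> set T) (p : R).
Hypothesis mA : forall j, measurable (A j).
Hypothesis PA : forall j, P (A j) = p%:E.
Hypothesis PAA : forall i j, i != j -> P (A i `&` A j) = (p * p)%:E.

Local Notation integ h := (P.-integrable setT (EFin \o (h : T -> R))).
Local Notation I h := (\int[P]_z (h : T -> R) z).

Definition occurrences n t : R := \sum_(j < n) \1_(A j) t.

Let integ_ind (B : set T) : measurable B -> integ (\1_B).
Proof.
move=> mB; apply: (@integ_bounded _ _ _ _ _ 1); first exact: measurable_indic.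
by move=> z; rewrite indicE normr_nat lern1 leq_b1.
Qed.

Let y j t : R := \1_(A j) t - p.

Let yy i j : (fun t => y i t * y j t) = (fun t => \1_(A i `&` A j) t +
  ((- p) * \1_(A i) t + ((- p) * \1_(A j) t + p * p))).
Proof. by apply/funext => t; rewrite /y indicI /=; ring. Qed.

Let integ_yy i j : integ (fun t => y i t * y j t).
Proof.
rewrite yy; apply: integD; first by apply: integ_ind; exact: measurableI.
apply: integD; first by apply: integZ; exact: integ_ind.
by apply: integD; [apply: integZ; exact: integ_ind | exact: integ_cst].
Qed.

Let integral_yy i j : I (fun t => y i t * y j t) = (i == j)%:R * (p - p * p).
Proof.
rewrite yy RintegralD//; [|by apply: integ_ind; exact: measurableI|]; last first.
  apply: integD; first by apply: integZ; exact: integ_ind.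
  by apply: integD; [apply: integZ; exact: integ_ind | exact: integ_cst].
rewrite RintegralD//; [|by apply: integZ; exact: integ_ind|]; last first.
  by apply: integD; [apply: integZ; exact: integ_ind | exact: integ_cst].
rewrite RintegralD//; [|by apply: integZ; exact: integ_ind|exact: integ_cst].
rewrite Rintegral_cst_probability !RintegralZl//; try exact: integ_ind.
rewrite !integral_indicator//; last exact: measurableI.
rewrite !PA; have [->|ij] := eqVneq i j.
  by rewrite setIid PA /=; ring.
by rewrite PAA//=; ring.
Qed.

(** Pairwise independence makes the centred indicators orthogonal, so the second
    moment is [n (p - p^2)]. *)
Lemma occurrences_variance n :
  integ (fun t => (occurrences n t - n%:R * p) ^+ 2) /\
  I (fun t => (occurrences n t - n%:R * p) ^+ 2) <= n%:R.
Proof.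
have E : (fun t => (occurrences n t - n%:R * p) ^+ 2) =
    (fun t => \sum_(i < n) \sum_(j < n) y i t * y j t).
  apply/funext => t; have -> : occurrences n t - n%:R * p = \sum_(i < n) y i t.
    by rewrite /y sumrB sumr_const card_ord mulr_natl.
  by rewrite expr2 big_distrlr.
have integ1 i : integ (fun t => \sum_(j < n) y i t * y j t).
  by apply: (@integ_sum _ _ _ P n (fun j t => y i t * y j t)) => j.
rewrite E; split.
  by apply: (@integ_sum _ _ _ P n (fun i t => \sum_(j < n) y i t * y j t)).
rewrite (@integral_sum _ _ _ P n (fun i t => \sum_(j < n) y i t * y j t))//.
rewrite (le_trans (y := \sum_(i < n) (1 : R)))//; last by rewrite sumr_const card_ord.
apply: ler_sum => i _; rewrite (@integral_sum _ _ _ P n (fun j t => y i t * y j t))//.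
rewrite (bigD1 i) //= big1 => [|j ji].
  rewrite integral_yy eqxx mul1r addr0.
  by have := sqr_ge0 (p - 1 / 2); rewrite expr2; lra.
by rewrite integral_yy [_ == _](negbTE _) ?mul0r// eq_sym.
Qed.

Let f k t : R := (occurrences (k.+1 ^ 2) t / (k.+1 ^ 2)%:R - p) ^+ 2.

Let fE k : f k = (fun t => (k.+1 ^ 2)%:R ^- 2 *
  (occurrences (k.+1 ^ 2) t - (k.+1 ^ 2)%:R * p) ^+ 2).
Proof.
apply/funext => t; rewrite /f.
have : (k.+1 ^ 2)%:R != 0 :> R by rewrite pnatr_eq0 expn_eq0.
by move: (_%:R) => x x0; field.
Qed.

Let integ_f k : integ (f k).
Proof. by rewrite fE; apply: integZ; have [] := occurrences_variance (k.+1 ^ 2). Qed.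

Let integral_f k : I (f k) <= k.+1%:R ^- 2.
Proof.
have [i1 i2] := occurrences_variance (k.+1 ^ 2).
rewrite fE RintegralZl//.
apply: (le_trans (ler_wpM2l _ i2)); first by rewrite invr_ge0 exprn_ge0.
rewrite natrX; have k0 : k.+1%:R != 0 :> R by rewrite pnatr_eq0.
rewrite le_eqVlt; apply/orP; left; apply/eqP.
by move: (k.+1%:R) k0 => x x0; field.
Qed.

(** Along the squares the second moments are summable.  Hence the series of the
    squared deviations is almost surely finite and its terms tend to 0. *)
Lemma occurrences_squares_ae : {ae P, forall t,
  occurrences (k.+1 ^ 2) t / (k.+1 ^ 2)%:R @[k --> \oo] --> p}.
Proof.
have mf k : measurable_fun setT (EFin \o f k).
  by have /integrableP[] := integ_f k.
have f0 k t : (0 <= (f k t)%:E)%E by rewrite lee_fin sqr_ge0.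
have sum2 : (\sum_(k <oo) \int[P]_t (f k t)%:E <= 2%:E)%E.
  apply: lime_le; first by apply: is_cvg_nneseries => k _ _; apply: integral_ge0.
  apply: nearW => N; rewrite big_mkord.
  apply: (@le_trans _ _ (\sum_(k < N) (k.+1%:R ^- 2 : R)%:E)%E).
    apply: lee_sum => k _.
    rewrite -[leLHS]fineK; first by rewrite lee_fin; exact: integral_f.
    by apply: integrable_fin_num => //; exact: integ_f.
  by rewrite sumEFin lee_fin sum_inv_sqr_le.
pose F t := (\sum_(k <oo) (f k t)%:E)%E.
have iF : P.-integrable setT F.
  apply/integrableP; split.
    by apply: ge0_emeasurable_sum => [k t _ _|k _]; [exact: f0 | exact: mf].
  have F0 t : (0 <= F t)%E by apply: nneseries_ge0.
  under eq_integral do rewrite gee0_abs//.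
  by rewrite integral_nneseries// (le_lt_trans sum2)// ltry.
have := integrable_ae measurableT iF; apply: filterS => t /(_ Logic.I) Ffin.
have fc : f ^~ t @ \oo --> (0 : R).
  apply: cvg_series_cvg_0; apply: nondecreasing_is_cvgn.
    apply/nondecreasing_seqP => n.
    by rewrite /series /= big_nat_recr//= lerDl sqr_ge0.
  exists (fine (F t)) => _ [n _ <-]; rewrite -lee_fin fineK//.
  rewrite /series /= -sumEFin; exact: nneseries_lim_ge.
rewrite -[X in _ --> X]add0r.
have -> : (fun k => occurrences (k.+1 ^ 2) t / (k.+1 ^ 2)%:R) =
    (fun k => (occurrences (k.+1 ^ 2) t / (k.+1 ^ 2)%:R - p) + p).
  by apply/funext => k; rewrite subrK.
apply: cvgD; last exact: cvg_cst.
apply/cvgr0Pnorm_lt => e e0.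
have e20 : 0 < e ^+ 2 by rewrite exprn_gt0.
move: fc => /cvgr0Pnorm_lt /(_ _ e20); apply: filterS => k.
by rewrite /f ger0_norm ?sqr_ge0// -real_normK ?num_real// ltr_pXn2r// nnegrE ltW.
Qed.

Theorem event_frequency_ae :
  {ae P, forall t, occurrences n t / n%:R @[n --> \oo] --> p}.
Proof.
have := occurrences_squares_ae; apply: filterS => t; apply: cvg_of_squares.
  move=> m n mn; rewrite /occurrences -!(big_mkord xpredT (fun j => \1_(A j) t : R)).
  rewrite [leRHS](big_cat_nat (n := m))//= lerDl sumr_ge0//.

by move=> n; rewrite sumr_ge0//.
Qed.

End EventFrequencies.

(** * Subsequences of unbounded sequences *)

Section Subsequences.
Variable R : realType.
Implicit Types u : nat -> R.

(** A bound on a tail of [u] would bound its limit superior. *)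
Lemma limn_esup_pinfty_unbounded u : limn_esup (EFin \o u) = +oo%E ->
  forall (M : R) N, exists2 n, (N <= n)%N & M < u n.
Proof.
move=> uoo M N; apply: contrapT => nex.
suff : (limn_esup (EFin \o u) <= M%:E)%E by rewrite uoo leye_eq.
rewrite /limn_esup limf_esupE.
apply: (@le_trans _ _ (ereal_sup ((EFin \o u) @` [set n | (N <= n)%N]))).
  by apply: ereal_inf_lbound; exists [set n | (N <= n)%N] => //; exact: nbhs_infty_ge.
apply: ge_ereal_sup => _ [n Nn <-]; rewrite lee_fin leNgt.
by apply/negP => Mu; apply: nex; exists n.
Qed.

(** The positivity of the values is what separates a subsequence of [u] from one of
    the opposite sequence. *)
Lemma unbounded_subsequence u :
  (forall (M : R) N, exists2 n, (N <= n)%N & M < u n) ->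
  exists k : nat -> nat, [/\ increasing_seq k, k @ \oo --> \oo,
    u (k i) @[i --> \oo] --> +oo & forall i, 0 < u (k i)].
Proof.
move=> unb.
have /choice[f fP] : forall iN : nat * nat, exists n, (iN.2 <= n)%N /\ iN.1%:R < u n.
  by move=> [i N]; have [n Nn iu] := unb i%:R N; exists n.
(* Each new index is larger than the previous one and carries a value above [i]. *)
pose k := fix k i := if i is j.+1 then f (i, (k j).+1) else f (0%N, 0%N).
have kS i : (k i < k i.+1)%N by have [] := fP (i.+1, (k i).+1).
have ku i : i%:R < u (k i) by case: i => [|i]; [have [] := fP (0%N, 0%N) | have [] := fP (i.+1, (k i).+1)].
have ki i : (i <= k i)%N by elim: i => // i IH; exact: leq_ltn_trans (kS i).
exists k; split.
- by apply/increasing_seqP.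
- by apply/cvgnyPge => N; exists N => // i /= Ni; exact: leq_trans (ki i).
- apply/cvgryPgt => M; near=> i; apply: lt_trans (ku i).
  by near: i; exact: nbhs_infty_gtr.
- by move=> i; apply: le_lt_trans (ku i).
Unshelve. all: by end_near. Qed.

End Subsequences.

(** * Random roots *)

Section RandomRoots.
Context (R : realType) (d : measure_display) (T : measurableType d).
Context (P : probability T R).
Implicit Types (X Y : nat -> {RV P >-> borelC R}) (mu nu : probability (borelC R) R).

Lemma independent_pair (I : choiceType) (Z : I -> {RV P >-> borelC R}) (i j : I)
    (A : set (borelC R)) : independent_RV Z -> measurable A -> i != j ->
  P (Z i @^-1` A `&` Z j @^-1` A) = (P (Z i @^-1` A) * P (Z j @^-1` A))%E.
Proof.
move=> indep mA ij; have := indep [fset i; j]%fset (fun=> A) (fun=> mA).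
rewrite big_fsetU1 ?inE//= big_seq_fset1 => <-; congr (P _).
apply/seteqP; split => t.
  by move=> [ti tj] x /=; rewrite !inE => /orP[/eqP->|/eqP->].
by move=> tij; split; apply: tij; rewrite /= !inE eqxx ?orbT.
Qed.

Lemma equidistributed_ae X mu :
  (forall i j A, measurable A -> i != j ->
     P (X i @^-1` A `&` X j @^-1` A) = (P (X i @^-1` A) * P (X j @^-1` A))%E) ->
  (forall j, has_law (X j) mu) ->
  {ae P, forall t, equidistributed mu (fun j => X j t)}.
Proof.
move=> indep law; apply/ae_foralln => m; apply/ae_foralln => k.
have mD := measurable_cell (R := R) m k.
have muD : mu (cell_set m k) = (fine (mu (cell_set m k)))%:E.
  by rewrite fineK// fin_num_measure.
have lawD j : P (X j @^-1` cell_set m k) = (fine (mu (cell_set m k)))%:E.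
  by rewrite -muD; exact: (law j _ mD).
have mXD j : measurable (X j @^-1` cell_set m k).
  by rewrite -[X in measurable X]setTI; exact: measurable_funP.
have pairD i j : i != j -> P (X i @^-1` cell_set m k `&` X j @^-1` cell_set m k) =
    (fine (mu (cell_set m k)) * fine (mu (cell_set m k)))%:E.
  by move=> ij; rewrite indep// !lawD EFinM.
have := event_frequency_ae mXD lawD pairD; apply: filterS => t.
have -> // : (fun n => occurrences R (fun j => X j @^-1` cell_set m k) n t / n%:R) =
  (fun n => avg (mkseq (fun j => X j t : R[i]) n) (fun z => (cell_index m z == k)%:R)).
apply/funext => n; rewrite /avg size_mkseq big_mkseq mulrC; congr (_ * _).
apply: eq_bigr => j _; rewrite indicE; congr (nat_of_bool _)%:R.
by apply/idP/eqP; rewrite inE.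
Qed.

End RandomRoots.

Section Paths.
Variable R : realType.
Implicit Types a b : nat -> R[i].

Lemma sum_rootsC a b n : sum_roots a b n = sum_roots b a n.
Proof. by rewrite /sum_roots addrC. Qed.

Lemma log_mahler_gapC a b n : log_mahler_gap a b n = - log_mahler_gap b a n.
Proof. by rewrite /log_mahler_gap -mulrN opprB. Qed.

End Paths.

Unset Implicit Arguments.

(** * Convergence of the roots of the sum *)

Theorem theorem1p7 (R : realType) (d : measure_display) (T : measurableType d)
    (P : probability T R) (mu nu : probability (borelC R) R)
    (hmu : ~ P_log_plus mu)
    (X Y : nat -> {RV P >-> borelC R})
    (hindep : independent_RV (join_family X Y))
    (hX : forall j : nat, has_law (X j) mu)
    (hY : forall j : nat, has_law (Y j) nu) :
  [/\ {ae P, forall t, mahler_diff X Y n t @[n --> \oo] --> +oo} ->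
        weak_cvg_as P (root_measure X Y) mu,
      {ae P, forall t, mahler_diff X Y n t @[n --> \oo] --> -oo} ->
        weak_cvg_as P (root_measure X Y) nu
    & {ae P, forall t,
         limn_esup (fun n => (mahler_diff X Y n t)%:E) = +oo%E /\
         limn_einf (fun n => (mahler_diff X Y n t)%:E) = -oo%E} ->
        {ae P, forall t, exists k l : nat -> nat,
          [/\ increasing_seq k, increasing_seq l,
              (forall i j : nat, k i <> l j),
              weak_cvg (fun i => root_measure X Y (k i) t) mu
            & weak_cvg (fun i => root_measure X Y (l i) t) nu]}].

Proof.
have inlP i j A : measurable A -> i != j ->
    P (X i @^-1` A `&` X j @^-1` A) = (P (X i @^-1` A) * P (X j @^-1` A))%E.
  move=> mA ij; apply: (@independent_pair _ _ _ P _ _ (inl i) (inl j) A hindep mA).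
  by apply: contra ij => /eqP[->].
have inrP i j A : measurable A -> i != j ->
    P (Y i @^-1` A `&` Y j @^-1` A) = (P (Y i @^-1` A) * P (Y j @^-1` A))%E.
  move=> mA ij; apply: (@independent_pair _ _ _ P _ _ (inr i) (inr j) A hindep mA).
  by apply: contra ij => /eqP[->].
have eqX := equidistributed_ae inlP hX.
have eqY := equidistributed_ae inrP hY.
pose x t j : R[i] := X j t; pose y t j : R[i] := Y j t.
have rootsC t n : root_measure X Y n t = empirical (sum_roots (y t) (x t) n).
  by rewrite sum_rootsC.
have gapC t n : log_mahler_gap (y t) (x t) n = - mahler_diff X Y n t.
  by rewrite log_mahler_gapC.
split.
- move=> gap phi phiP; apply: filterS2 eqX gap => t eqx gapt.
  exact: (@sum_roots_weak_cvg _ mu (x t) (y t) id eqx cvg_id gapt phi phiP).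
- move=> gap phi phiP; apply: filterS2 eqY gap => t eqy gapt.
  have -> : root_measure X Y ^~ t = (fun n => empirical (sum_roots (y t) (x t) n)).
    by apply/funext => n; rewrite rootsC.
  apply: (@sum_roots_weak_cvg _ nu (y t) (x t) id eqy cvg_id _ phi phiP).
  by under eq_fun do rewrite gapC; apply/cvgNry.
- move=> osc; apply: filterS3 eqX eqY osc => t eqx eqy [supt inft].
  have [k [ki koo kgap kpos]] := unbounded_subsequence (limn_esup_pinfty_unbounded supt).
  have inft' : limn_esup (EFin \o (fun n => log_mahler_gap (y t) (x t) n)) = +oo%E.
    have -> : EFin \o (fun n => log_mahler_gap (y t) (x t) n) =
        (\- (fun n => (mahler_diff X Y n t)%:E))%E.
      by apply/funext => n /=; rewrite gapC.
    by apply: oppe_inj; exact: inft.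
  have [l [li loo lgap lpos]] := unbounded_subsequence (limn_esup_pinfty_unbounded inft').
  exists k, l; split => //.
  + move=> i j kl; have := kpos i; have := lpos j.
    by rewrite gapC kl oppr_gt0 => /lt_trans h /h; rewrite ltxx.
  + exact: (@sum_roots_weak_cvg _ mu (x t) (y t) k eqx koo kgap).
  + have -> : (fun i => root_measure X Y (l i) t) =
        (fun i => empirical (sum_roots (y t) (x t) (l i))).
      by apply/funext => i; rewrite rootsC.
    exact: (@sum_roots_weak_cvg _ nu (y t) (x t) l eqy loo lgap).
Qed.
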